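(* Let $(M,\omega)$ be a weighted brick complex and let $\mathcal{O}$ be a locally thin ordering of $M$, with level sets $S_j$. Then the following hold. (1) If $j$ is a (local) maximum of $\mathcal{O}$, then $S_j$ is either a stable minimal surface or an unstable minimal surface. If $j$ is an extremal maximum, then $S_j$ is an unstable minimal surface. (2) If $j$ is a (local) minimum of $\mathcal{O}$, then $S_j$ is a stable minimal surface.
   Context: **Brick complexes.** A $0$-brick is a single point. For $n\ge 1$, an $n$-brick is a compact $n$-dimensional manifold $T$ with $\partial T$ tiled by finitely many $(n-1)$-bricks, called the facets of $T$. Tilings are face-to-face, so each $(n-2)$-dimensional face in $\partial T$ is a facet of exactly two facets of $T$. Faces of $T$ are defined recursively: facets, facets of facets, etc. A gluing map from an $n$-brick $T_1$ to a distinct $n$-brick $T_2$ is a homeomorphism from the union of some facets of $T_1$ to the union of some facets of $T_2$ taking each face to a face. An ($n$-dimensional) brick complex $M$ (or $(M,\mathcal{T})$) is a topological space $M$ with a finite collection $\mathcal{T}$ of $n$-bricks and gluing maps between them such that each facet of each brick is contained in the domain or range of at most one gluing map, and $M$ is homeomorphic to the resulting quotient space. Images in $M$ of the $n$-bricks and of their facets are again called bricks and facets. Thus each facet of $M$ is a facet of either one or two (distinct) bricks. $\mathcal{F}$ is the set of facets of $M$, and $\partial M$ is the set of facets adjacent to exactly one brick. For a brick $A$, $\partial A$ is its set of facets and $\partial_I A$ is the set of facets of $A$ not in $\partial M$ (interior facets). **Surfaces and weights.** A surface $S\subset M$ is a union of facets, identified with its set of facets (the facets ''in'' $S$); the empty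 surface is allowed. The facets ''of'' $S$ are the $(n-2)$-dimensional faces of $M$ belonging to $S$. $S$ is proper if no facet in $S$ is in $\partial M$ and, for every $(n-2)$-dimensional face $\alpha$ belonging to $S$ and not lying in $\partial M$, the number of facets in $S$ having $\alpha$ as a facet is even (counted with multiplicity: a facet $F$ in $S$ is counted once for each facet of the brick $F$ whose image in $M$ is $\alpha$). $S_1\sqcap S_2$ denotes the set of facets common to $S_1$ and $S_2$ (and $A\sqcap S$ means $\partial A\sqcap S$ for a brick $A$). A weight system is a function $\omega:\mathcal{F}\to[0,\infty)$; the weight $\omega(S)$ of a union of facets is the sum of the weights of its facets. $(M,\omega)$ is then a weighted brick complex. For a brick $A$ and a surface $S$, $\partial_S A$ is the set of facets of $\partial_I A$ in $S$, $\partial'_S A$ is the set of facets of $\partial_I A$ not in $S$, and the strength of $A$ relative to $S$ is $\sigma(A;S)=\omega(\partial'_S A)-\omega(\partial_S A)$. $A$ is a shortening move for $S$ if $A\sqcap S\ne\varnothing$ and $\sigma(A;S)\le 0$; it is a strict shortening move if moreover $\sigma(A;S)<0$. **Minimal surfaces.** A proper surface $S$ is a stable minimal surface if it has no strict shortening moves. A proper surface $S$ is an unstable minimal surface if there is a partition of the bricks of $M$ into two non-empty sets $\mathcal{A},\mathcal{B}$ such that: (i) if $A\in\mathcal{A}$ and $B\in\mathcal{B}$, then $\partial A\sqcap\partial B\subset S$; (ii) each of $\mathcal{A}$ and $\mathcal{B}$ contains a shortening move for $S$ and one of them contains a strict shortening move; (iii) for each strict shortening move $A\in\mathcal{A}$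 (resp. $B\in\mathcal{B}$) there exists a shortening move $B\in\mathcal{B}$ (resp. $A\in\mathcal{A}$) such that $2\omega(\partial A\sqcap\partial B)\ge|\sigma(A;S)|+|\sigma(B;S)|$; (iv) for all strict shortening moves $A\in\mathcal{A}$ and strict shortening moves $B\in\mathcal{B}$, $2\omega(\partial A\sqcap\partial B)\ge|\sigma(A;S)|+|\sigma(B;S)|$. **Orderings.** Let $N=|\mathcal{T}|$, $[N]=\{1,\dots,N\}$, $[N]^*=[N]\cup\{0\}$. An ordering is a bijection $\mathcal{O}:\mathcal{T}\to[N]$; write $T_i=\mathcal{O}^{-1}(i)$. For $j\in[N]^*$, $M_j=\bigcup_{i\le j}T_i$, $M_j^C=\bigcup_{i>j}T_i$, the level set $S_j$ consists of all facets of $M$ in $M_j\cap M_j^C$ (facets shared by a brick $T_i$ with $i\le j$ and a brick $T_k$ with $k>j$), and $\Lambda(j)=\omega(S_j)$. A number $t\in[N-1]$ is a (local) maximum for $\mathcal{O}$ if there exist $t_-,t_+\in[N]^*$ with $t_-<t<t_+$, $\Lambda(t_-)<\Lambda(t_-+1)$, $\Lambda(t_+)<\Lambda(t_+-1)$, and $\Lambda(t)=\Lambda(k)$ for all $k\in\{t_-+1,\dots,t_+-1\}$. (Local) minima are defined by reversing the first two inequalities between values of $\Lambda$. The maximum or minimum is extremal if $t=t_-+1$ or $t=t_+-1$. The width $\Omega(\mathcal{O})$ is the sequence of values of $\Lambda$ at the maxima of $\mathcal{O}$, in non-increasing order with repetitions; widths are compared lexicographically (a proper initial segment being smaller). **Thinning.**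 Let $\tau_i$ be the transposition of $i$ and $i+1$. If $\mathcal{O}'=\tau_i\circ\mathcal{O}$ for some $i\in[N-1]$ and $\Omega(\mathcal{O}')\le\Omega(\mathcal{O})$, then $\mathcal{O}$ thins to $\mathcal{O}'$; ''thins to'' is extended to be reflexive and transitive. An ordering is locally thin if it does not thin to any ordering of strictly smaller width. *)

(* Defs.v *)
From HB Require Import structures.
From Stdlib Require Import Relation_Operators.
From mathcomp Require Import all_boot all_order all_algebra.
From mathcomp Require Import all_classical all_reals all_analysis.

Set Implicit Arguments.
Unset Strict Implicit.
Unset Printing Implicit Defensive.

Import Order.TTheory GRing.Theory Num.Theory.
Import numFieldNormedType.Exports.

Local Open Scope classical_set_scope.
Local Open Scope ring_scope.

(** * Compact manifolds with boundary *)

Definition homeo_on (X Y : topologicalType) (A : set X) (B : set Y)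
    (f : X -> Y) : Prop :=
  exists g : Y -> X,
    [/\ set_bij A B f, {in A, cancel f g},
        {within A, continuous f} & {within B, continuous g}].

Definition half_space (R : realType) (d : nat) : set 'rV[R]_d.+1 :=
  [set v | 0 <= v ord0 ord0].
Arguments half_space : clear implicits.

Definition interior_point (R : realType) (d : nat) (Y : topologicalType)
    (y : Y) : Prop :=
  exists (U : set Y) (V : set 'rV[R]_d.+1) (f : Y -> 'rV[R]_d.+1),
    [/\ open U, U y, open V & homeo_on U V f].
Arguments interior_point R d {Y} y.

Definition chart_point (R : realType) (d : nat) (Y : topologicalType)
    (y : Y) : Prop :=
  exists (U : set Y) (V : set 'rV[R]_d.+1) (f : Y -> 'rV[R]_d.+1),
    [/\ open U, U y, open V & homeo_on U (V `&` half_space R d) f].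
Arguments chart_point R d {Y} y.

(* The dimension is d.+1.  Nonemptiness is what makes the dimension
   meaningful. *)
Definition compact_manifold (R : realType) (d : nat) (Y : topologicalType) :
    Prop :=
  [/\ [set: Y] !=set0, compact [set: Y], hausdorff_space Y,
      @second_countable Y & forall y : Y, chart_point R d y].
Arguments compact_manifold R d Y : clear implicits.

(* For a subset A of X with the induced topology (the type A is the subtype
   [set_type A]); the result is viewed as a subset of X. *)
Definition manifold_boundary (R : realType) (d : nat) (X : topologicalType)
    (A : set X) : set X :=
  [set set_val y | y in [set y : A | ~ interior_point R d y]].
Arguments manifold_boundary R d {X} A.

(** * Bricks *)

(* The data of an n-brick lying in a space X: its underlying point set and, if
   n > 0, the set of its facets, which are themselves (n-1)-brick data in X.
   Thus two faces are equal when they have the same points and, recursively,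
   the same faces. *)
Fixpoint bdata (X : Type) (n : nat) : Type :=
  match n with
  | 0%N => set X
  | m.+1 => (set X * set (bdata X m))%type
  end.

Definition carrier (X : Type) (n : nat) : bdata X n -> set X :=
  match n return bdata X n -> set X with
  | 0%N => fun T => T
  | _.+1 => fun T => T.1
  end.
Arguments carrier {X n} T.

(* A 0-brick has no facets. *)
Definition facets (X : Type) (n : nat) : bdata X n -> set (bdata X n.-1) :=
  match n return bdata X n -> set (bdata X n.-1) with
  | 0%N => fun _ => set0
  | _.+1 => fun T => T.2
  end.
Arguments facets {X n} T.

(* Facets, facets of facets, and so on, each tagged with its dimension. *)
Fixpoint faces (X : Type) (n : nat) : bdata X n -> set {k : nat & bdata X k} :=
  match n return bdata X n -> set {k : nat & bdata X k} with
  | 0%N => fun _ => set0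
  | m.+1 => fun T =>
      \bigcup_(F in T.2) ([set existT (bdata X) m F] `|` @faces X m F)
  end.
Arguments faces {X n} T.

(* The image of a brick together with the images of all its faces. *)
Fixpoint bimage (X Y : Type) (f : X -> Y) (n : nat) : bdata X n -> bdata Y n :=
  match n return bdata X n -> bdata Y n with
  | 0%N => fun T => f @` T
  | m.+1 => fun T => (f @` T.1, @bimage X Y f m @` T.2)
  end.
Arguments bimage {X Y} f {n} T.

(* The facets tile the boundary face-to-face: two distinct facets meet exactly
   in the union of their common (proper) faces, and each facet of a facet is a
   facet of exactly two facets. *)
Fixpoint is_brick (R : realType) (X : topologicalType) (n : nat) :
    bdata X n -> Prop :=
  match n return bdata X n -> Prop with
  | 0%N => fun T => exists x : X, T = [set x]
  | m.+1 => fun T =>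
      [/\ compact_manifold R m (set_type T.1),
          finite_set T.2 /\ (forall F, T.2 F -> @is_brick R X m F),
          \bigcup_(F in T.2) carrier F = manifold_boundary R m T.1,
          forall F1 F2, T.2 F1 -> T.2 F2 -> F1 <> F2 ->
            carrier F1 `&` carrier F2 =
            \bigcup_(G in faces F1 `&` faces F2) carrier (projT2 G)
        & forall G : bdata X m.-1,
            (exists2 F, T.2 F & facets F G) ->
            ([set F | T.2 F /\ facets F G] #= `I_2)%card]
  end.
Arguments is_brick R {X n} T.

(** * Brick complexes *)

(* The map is only relevant on the union of the facets in [gdom].  The facets
   are taken to facets through [bimage], i.e. together with all their faces;
   the range is then the union of the facets in [gran]. *)
Record gluing (n : nat) (X1 X2 : topologicalType)
    (T1 : bdata X1 n) (T2 : bdata X2 n) := Gluing {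
  gmap : X1 -> X2;
  gdom : set (bdata X1 n.-1);
  gran := [set bimage gmap F | F in gdom];
  gdom_facets : gdom `<=` facets T1;
  gran_facets : gran `<=` facets T2;
  gmap_homeo : homeo_on (\bigcup_(F in gdom) carrier F)
                        (\bigcup_(F in gran) carrier F) gmap }.

(* An n-dimensional brick complex structure on M.  The map [proj] identifies M
   with the quotient of the disjoint union of the bricks by the equivalence
   relation generated by the gluing maps. *)
Record brick_complex (R : realType) (n : nat) (M : topologicalType) :=
  BrickComplex {
  brick : finType;
  space : brick -> topologicalType;
  cell : forall i : brick, bdata (space i) n;
  cell_full : forall i, carrier (cell i) = [set: space i];
  cell_brick : forall i, is_brick R (cell i);
  gidx : finType;
  gsrc : gidx -> brick;
  gtgt : gidx -> brick;
  gsrc_neq_gtgt : forall g, gsrc g <> gtgt g;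
  glue : forall g, gluing (cell (gsrc g)) (cell (gtgt g));
  attached := fun g : gidx =>
    [set existT (fun i => bdata (space i) n.-1) (gsrc g) F
       | F in gdom (glue g)] `|`
    [set existT (fun i => bdata (space i) n.-1) (gtgt g) F
       | F in gran (glue g)];
  attached_inj : forall g g' F, attached g F -> attached g' F -> g = g';
  identified := fun x y : {i : brick & space i} =>
    exists g p, [/\ (\bigcup_(F in gdom (glue g)) carrier F) p,
                    x = existT space (gsrc g) p &
                    y = existT space (gtgt g) (gmap (glue g) p)];
  proj : {i : brick & space i} -> M;
  proj_surj : forall m, exists x, proj x = m;
  proj_fibers : forall x y,
    proj x = proj y <-> clos_refl_sym_trans _ identified x y;
  proj_quotient : forall U : set M, open U <-> open (proj @^-1` U) }.

Definition image_in (R : realType) (n : nat) (M : topologicalType)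
    (C : brick_complex R n M) (i : brick C) (A : set (space i)) : set M :=
  [set proj (existT (@space _ _ _ C) i p) | p in A].

(* The set of facets (in M) of the brick A. *)
Definition brick_facets (R : realType) (n : nat) (M : topologicalType)
    (C : brick_complex R n M) (A : brick C) : set (set M) :=
  [set image_in (carrier F) | F in facets (cell A)].

Definition complex_facets (R : realType) (n : nat) (M : topologicalType)
    (C : brick_complex R n M) : set (set M) :=
  \bigcup_(A in [set: brick C]) brick_facets A.

Definition boundary_facets (R : realType) (n : nat) (M : topologicalType)
    (C : brick_complex R n M) : set (set M) :=
  [set F | exists! A : brick C, brick_facets A F].

Definition interior_facets (R : realType) (n : nat) (M : topologicalType)
    (C : brick_complex R n M) (A : brick C) : set (set M) :=
  brick_facets A `\` boundary_facets C.

(** * Surfaces and weights *)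

(* A facet F of M is the image of a brick; k of the facets of that brick have
   image alpha.  The number k does not depend on the brick chosen, since the
   gluing maps carry faces to faces. *)
Definition has_multiplicity (R : realType) (n : nat) (M : topologicalType)
    (C : brick_complex R n M) (alpha F : set M) (k : nat) : Prop :=
  exists (A : brick C) (F' : bdata (space A) n.-1),
    [/\ facets (cell A) F', image_in (carrier F') = F &
        ([set G | facets F' G /\ image_in (carrier G) = alpha] #= `I_k)%card].

Definition multiplicity (R : realType) (n : nat) (M : topologicalType)
    (C : brick_complex R n M) (alpha F : set M) : nat :=
  xget 0%N [set k | has_multiplicity C alpha F k].

(* The (n-2)-dimensional faces of M belonging to S. *)
Definition surface_facets (R : realType) (n : nat) (M : topologicalType)
    (C : brick_complex R n M) (S : set (set M)) : set (set M) :=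
  [set alpha | exists (A : brick C) (F' : bdata (space A) n.-1)
      (G : bdata (space A) n.-1.-1),
    [/\ facets (cell A) F', S (image_in (carrier F')), facets F' G &
        image_in (carrier G) = alpha]].

(* A surface is a set S of facets of M. *)
Definition proper_surface (R : realType) (n : nat) (M : topologicalType)
    (C : brick_complex R n M) (S : set (set M)) : Prop :=
  [/\ S `<=` complex_facets C,
      S `&` boundary_facets C = set0
    & forall alpha : set M, surface_facets C S alpha ->
        ~ alpha `<=` \bigcup_(F in boundary_facets C) F ->
        ~~ odd (\sum_(F \in S) multiplicity C alpha F)].

Definition weight (R : realType) (M : Type) (w : set M -> R)
    (S : set (set M)) : R :=
  \sum_(F \in S) w F.

(* Only the values on the facets of M matter. *)
Definition weight_system (R : realType) (n : nat) (M : topologicalType)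
    (C : brick_complex R n M) (w : set M -> R) : Prop :=
  forall F, complex_facets C F -> 0 <= w F.

Definition strength (R : realType) (n : nat) (M : topologicalType)
    (C : brick_complex R n M) (w : set M -> R) (S : set (set M))
    (A : brick C) : R :=
  weight w (interior_facets A `\` S) - weight w (interior_facets A `&` S).

Definition shortening (R : realType) (n : nat) (M : topologicalType)
    (C : brick_complex R n M) (w : set M -> R) (S : set (set M))
    (A : brick C) : Prop :=
  brick_facets A `&` S !=set0 /\ strength w S A <= 0.

Definition strict_shortening (R : realType) (n : nat) (M : topologicalType)
    (C : brick_complex R n M) (w : set M -> R) (S : set (set M))
    (A : brick C) : Prop :=
  shortening w S A /\ strength w S A < 0.

(** * Minimal surfaces *)

Definition stable_minimal (R : realType) (n : nat) (M : topologicalType)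
    (C : brick_complex R n M) (w : set M -> R) (S : set (set M)) : Prop :=
  proper_surface C S /\ ~ exists A : brick C, strict_shortening w S A.

(* 2 w(dA cap dB) >= |sigma(A; S)| + |sigma(B; S)| *)
Definition interfere (R : realType) (n : nat) (M : topologicalType)
    (C : brick_complex R n M) (w : set M -> R) (S : set (set M))
    (A B : brick C) : Prop :=
  `|strength w S A| + `|strength w S B|
    <= 2 * weight w (brick_facets A `&` brick_facets B).

Definition unstable_minimal (R : realType) (n : nat) (M : topologicalType)
    (C : brick_complex R n M) (w : set M -> R) (S : set (set M)) : Prop :=
  proper_surface C S /\
  exists a b : set (brick C),
    [/\ a !=set0, b !=set0, a `|` b = [set: brick C] & a `&` b = set0] /\
    [/\ forall A B, a A -> b B -> brick_facets A `&` brick_facets B `<=` S,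
        [/\ exists2 A, a A & shortening w S A,
            exists2 B, b B & shortening w S B
          & (exists2 A, a A & strict_shortening w S A) \/
            (exists2 B, b B & strict_shortening w S B)],
        (forall A, a A -> strict_shortening w S A ->
           exists B, [/\ b B, shortening w S B & interfere w S A B]) /\
        (forall B, b B -> strict_shortening w S B ->
           exists A, [/\ a A, shortening w S A & interfere w S A B])
      & forall A B, a A -> b B ->
          strict_shortening w S A -> strict_shortening w S B ->
          interfere w S A B].

(** * Orderings *)

(* Labels are 1, ..., N, where N is the number of bricks. *)
Definition is_ordering (B : finType) (O : B -> nat) : Prop :=
  set_bij [set: B] [set k : nat | (1 <= k <= #|B|)%N] O.

Definition level_set (R : realType) (n : nat) (M : topologicalType)
    (C : brick_complex R n M) (O : brick C -> nat) (j : nat) : set (set M) :=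
  [set F | exists A B : brick C,
     [/\ (O A <= j)%N, (j < O B)%N, brick_facets A F & brick_facets B F]].

Definition level_weight (R : realType) (n : nat) (M : topologicalType)
    (C : brick_complex R n M) (w : set M -> R) (O : brick C -> nat)
    (j : nat) : R :=
  weight w (level_set O j).

(* L : {0, ..., N} -> R is constant, with value L t, strictly between tm and
   tp, where tm < t < tp. *)
Definition plateau (R : realType) (N : nat) (L : nat -> R) (t tm tp : nat) :
    Prop :=
  [/\ (1 <= t <= N.-1)%N, (tm < t < tp)%N, (tp <= N)%N &
      forall k, (tm < k < tp)%N -> L t = L k].

Definition is_maximum (R : realType) (N : nat) (L : nat -> R) (t : nat) :
    Prop :=
  exists tm tp : nat,
    [/\ plateau N L t tm tp, L tm < L tm.+1 & L tp < L tp.-1].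

Definition is_minimum (R : realType) (N : nat) (L : nat -> R) (t : nat) :
    Prop :=
  exists tm tp : nat,
    [/\ plateau N L t tm tp, L tm > L tm.+1 & L tp > L tp.-1].

Definition is_extremal_maximum (R : realType) (N : nat) (L : nat -> R)
    (t : nat) : Prop :=
  exists tm tp : nat,
    [/\ plateau N L t tm tp, L tm < L tm.+1, L tp < L tp.-1 &
        t = tm.+1 \/ t = tp.-1].

(* [seqlexi R] is the type of sequences ordered lexicographically. *)
Definition width (R : realType) (n : nat) (M : topologicalType)
    (C : brick_complex R n M) (w : set M -> R) (O : brick C -> nat) :
    seqlexi R :=
  let N := #|brick C| in
  let L := level_weight w O in
  sort (fun x y : R => y <= x)
       [seq L t | t <- iota 1 N.-1 & `[< is_maximum N L t >]].

(** * Thinning *)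

Definition transposition (i k : nat) : nat :=
  if k == i then i.+1 else if k == i.+1 then i else k.

Definition thins_once (R : realType) (n : nat) (M : topologicalType)
    (C : brick_complex R n M) (w : set M -> R) (O O' : brick C -> nat) :
    Prop :=
  exists i : nat,
    [/\ (1 <= i <= #|brick C|.-1)%N, O' = transposition i \o O &
        (width w O' <= width w O)%O].

Definition thins_to (R : realType) (n : nat) (M : topologicalType)
    (C : brick_complex R n M) (w : set M -> R) :
    (brick C -> nat) -> (brick C -> nat) -> Prop :=
  clos_refl_trans (brick C -> nat) (thins_once w).

Definition locally_thin (R : realType) (n : nat) (M : topologicalType)
    (C : brick_complex R n M) (w : set M -> R) (O : brick C -> nat) : Prop :=
  ~ exists2 O', thins_to w O O' & (width w O' < width w O)%O.

(* Main.v *)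
Require Import Defs.
From Stdlib Require Import Relation_Operators Eqdep_dec.
From mathcomp Require Import all_boot all_order all_algebra finmap.
From mathcomp Require Import all_classical all_reals all_analysis.
From mathcomp Require Import zify lra.

Set Implicit Arguments.
Unset Strict Implicit.
Unset Printing Implicit Defensive.

Import Order.TTheory GRing.Theory Num.Theory.
Import numFieldNormedType.Exports.
(* The second import restores the name glue, which also denotes the gluing of
   two functions along disjoint domains. *)
Import Defs.

(** The proof has a topological half and a combinatorial half.

    Topologically, an interior point [p] of a facet of a brick is moved by at
    most one gluing map, because the facet is attached at most once; since
    gluing maps carry interiors of facets to interiors of facets, the point
    of [M] below [p] comes from [p] and at most one further point, which lies
    in another brick ([facet_point_class]).  Hence distinct facets of a brick
    have distinct images, a facet of [M] lies in at most two bricks, and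
    multiplicities do not depend on the brick used to compute them
    ([image_in_inj], [facet_two_bricks], [multiplicityP]).  Each brick meets a
    codimension two face [alpha] an even number of times, because every facet
    of a facet lies in exactly two facets.  Summing over the bricks before the
    level [j] counts the facets inside twice and those of the level set once,
    so level sets are proper ([level_set_proper]).

    Combinatorially, bricks are the vertices of a graph whose edges are
    weighted by the shared facets; [Lambda(j)] is the cut of the first [j]
    bricks, and the strength of [A] is the change of the cut when [A] changes
    sides.  A transposition of adjacent bricks changes [Lambda] at one index
    only, so its effect on the width is decided by three neighbouring values:
    lowering a maximum that ends an ascent lowers the width, and the width
    cannot grow where submodularity of cuts controls the new value
    ([width_lt_of_lowered_maximum], [width_le_of_ascent]).

    Let [A] come before the level [j] with negative strength there.  By
    submodularity its strength is negative at all earlier levels, so moving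
    [A] up to position [j] never increases the width; local thinness then
    forces [Lambda] to rise at [A] and not to fall from there up to [j]
    ([move_up]).  At a minimum this is absurd.  At a maximum, [A] now sits just
    below the level, and exchanging it with the next brick [B] would lower a
    maximum unless twice the shared weight of [A] and [B] is at least the sum
    of the absolute strengths; this is the interference required of an
    unstable minimal surface ([interfere_at_maximum]).  Bricks after the level
    are handled by reversing the ordering.  At an extremal maximum one of the
    two bricks next to the level has negative strength. *)

Local Open Scope classical_set_scope.
Local Open Scope ring_scope.

(** * Interior points of bricks *)

Lemma sigT_inj (I : eqType) (P : I -> Type) (i : I) (x y : P i) :
  existT P i x = existT P i y -> x = y.
Proof. by apply: inj_pair2_eq_dec => a b; exact: eq_comparable. Qed.

(** A boundary chart contains a point with positive first coordinate: push the
    centre of the chart into the open half-space. The chart restricted to that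
    open half-space shows that the point is interior. *)
Lemma compact_manifold_interior (R : realType) (d : nat) (Y : topologicalType) :
  compact_manifold R d Y -> exists y : Y, interior_point R d y.
Proof.
move=> [[y0 _] _ _ _ /(_ y0)] [U [V [f [oU Uy0 oV]]]].
move=> [g [[fUV finj fsurj] fK fcont gcont]].
have [Vv Hv] := fUV _ Uy0; set v := f y0 in Vv Hv.
have [e [e0 eV]] : exists e : R, 0 < e /\ V (v + e *: delta_mx ord0 ord0).
  have : (fun e : R => v + e *: delta_mx ord0 ord0 : 'rV[R]_d.+1) e @[e --> (0:R)^'+] --> v.
    suff : (fun e : R => v + e *: delta_mx ord0 ord0 : 'rV[R]_d.+1) e
        @[e --> (0:R)^'+] --> v + 0 *: delta_mx ord0 ord0 by rewrite scale0r addr0.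
    apply: cvgD; first exact: cvg_cst.
    apply: cvgZr_tmp; apply: cvg_at_right_filter; exact: cvg_id.
  move=> /(_ V (open_nbhs_nbhs (conj oV Vv))) nV.
  have nV' : \forall e \near (0:R)^'+, V (v + e *: delta_mx ord0 ord0) by exact: nV.
  have [e [/= h1 h2]] := filter_ex (filterI nV' (nbhs_right_gt 0)).
  by exists e.
set v1 := v + _ in eV.
have v1pos : 0 < v1 ord0 ord0.
  rewrite /v1 !mxE !eqxx /= mulr1.
  by apply: ltr_wpDl => //; exact: Hv.
have [y Uy fy] : (f @` U) v1 by apply: fsurj; split => //; exact: ltW.
pose P : set 'rV[R]_d.+1 := [set u | 0 < u ord0 ord0].
have oP : open P.
  rewrite (_ : P = (fun u : 'rV[R]_d.+1 => u ord0 ord0) @^-1` [set x | 0 < x]) //.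
  apply: open_comp; last exact: open_gt.
  by move=> u _; exact: coord_continuous.
(* The chart restricted to the part with positive first coordinate. *)
exists y, (U `&` f @^-1` P), (V `&` P), f; split.
- rewrite openE => z [Uz Pz]; apply: filterI; first exact: open_nbhs_nbhs.
  move: fcont; rewrite continuous_open_subspace // => /(_ z (mem_set Uz)).
  by apply; exact: open_nbhs_nbhs.
- by split => //; rewrite /preimage /= fy.
- exact: openI.
- exists g; split.
  + split.
    * move=> z [Uz Pz]; split => //; by have [] := fUV _ Uz.
    * move=> a b; rewrite !inE => -[Ua _] [Ub _]; apply: finj; exact: mem_set.
    * move=> u [Vu Pu]; have [|z Uz zu] := fsurj u.
        by split => //; exact: ltW.
      by exists z => //; split => //; rewrite /preimage /= zu.
  + by move=> z; rewrite inE => -[Uz _]; apply: fK; exact: mem_set.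
  + by apply: continuous_subspaceW fcont => z [].
  + by apply: continuous_subspaceW gcont => z [Vz Pz]; split => //; exact: ltW.
Qed.

Definition brick_interior (X : Type) (n : nat) (T : bdata X n) : set X :=
  carrier T `\` \bigcup_(G in facets T) carrier G.

Section Bricks.
Variables (R : realType) (X : topologicalType).

Lemma brick_facet n (T : bdata X n) F :
  is_brick R T -> facets T F -> is_brick R F.
Proof. by case: n T F => [//|n] T F [_ [_ h] _ _ _] /h. Qed.

Lemma finite_facets n (T : bdata X n) : is_brick R T -> finite_set (facets T).
Proof. by case: n T => [T _|n T [_ [] //]]; exact: finite_set0. Qed.

Lemma facet_carrier n (T : bdata X n) F :
  is_brick R T -> facets T F -> carrier F `<=` carrier T.
Proof.
case: n T F => [//|n] T F [_ _ bd _ _] TF x Fx.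
have : manifold_boundary R n T.1 x by rewrite -bd; exists F.
by case=> y _ <-; exact: set_valP.
Qed.

(** Lower-dimensional faces are reached through facets, so the intersection of
    two facets avoids the interior of both. *)
Lemma faces_carrier n (T : bdata X n) H : is_brick R T -> faces T H ->
  exists2 F, facets T F & carrier (projT2 H) `<=` carrier F.
Proof.
elim: n T => [//|n IH] T bT [F TF [->|FH]]; first by exists F.
have bF : is_brick R F by exact: brick_facet bT TF.
exists F => //; have [G FG HG] := IH F bF FH.
by apply: subset_trans HG _; exact: facet_carrier bF FG.
Qed.

Lemma brick_interior_nonempty n (T : bdata X n) :
  is_brick R T -> exists x, brick_interior T x.
Proof.
case: n T => [T [x ->]|n T [mT _ bd _ _]]; first by exists x; split => // -[].
have [y yi] := compact_manifold_interior mT.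
exists (set_val y); split; first exact: set_valP.
move=> xb; have : manifold_boundary R n T.1 (set_val y) by rewrite -bd.
by case=> z zn /val_inj e; apply: zn; rewrite e.
Qed.

Lemma facet_interior_unique n (T : bdata X n) F1 F2 x : is_brick R T ->
  facets T F1 -> facets T F2 -> brick_interior F1 x -> carrier F2 x -> F1 = F2.
Proof.
case: n T F1 F2 => [//|n] T F1 F2 bT TF1 TF2 [F1x nF1x] F2x.
apply: contrapT => ne; case: (bT) => _ _ _ /(_ F1 F2 TF1 TF2 ne) I _.
have : (carrier F1 `&` carrier F2) x by [].
rewrite I => -[H [H1 _] Hx]; apply: nF1x.
have [G FG HG] := faces_carrier (brick_facet bT TF1) H1.
by exists G => //; exact: HG.
Qed.

Lemma ridge_two_facets n (T : bdata X n) (G : bdata X n.-1.-1) :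
  is_brick R T -> (exists2 F, facets T F & facets F G) ->
  ([set F | facets T F /\ facets F G] #= `I_2)%card.
Proof. by case: n T G => [T G _ []//|n] T G [_ _ _ _ h] /h. Qed.

End Bricks.

Section BrickImage.
Variables (X Y : topologicalType) (f : X -> Y).

Lemma carrier_bimage n (T : bdata X n) : carrier (bimage f T) = f @` carrier T.
Proof. by case: n T. Qed.

Lemma facets_bimage n (T : bdata X n) :
  facets (bimage f T) = bimage f @` facets T.
Proof. by case: n T => [T|n T] //=; rewrite image_set0. Qed.

(** The left inverse of [f] need only be correct on a set containing [T]: a
    gluing map is injective on its domain only. *)
Lemma bimageK (R : realType) (D : set X) (g : Y -> X) n (T : bdata X n) :
  {in D, cancel f g} -> is_brick R T -> carrier T `<=` D ->
  bimage g (bimage f T) = T.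
Proof.
move=> fK; have imK (A : set X) : A `<=` D -> g @` (f @` A) = A.
  move=> AD; rewrite image_comp; apply: eq_image_id => x Ax /=.
  by apply: fK; apply/mem_set/AD.
elim: n T => [T _|n IH T bT TD]; first exact: imK.
case: T bT TD => A S bT TD /=; congr pair; first exact: imK.
rewrite image_comp; apply: eq_image_id => F SF /=; apply: IH.
  exact: brick_facet bT _.
by apply: subset_trans TD; exact: (facet_carrier bT).
Qed.

End BrickImage.

(** * Facets of a brick complex *)

Section Identification.
Variables (R : realType) (n : nat) (M : topologicalType).
Variable C : brick_complex R n M.

Local Notation pt i p := (existT (@space _ _ _ C) i p).
Local Notation fc i F := (existT (fun j : brick C => bdata (space j) n.-1) i F).

Lemma gmap_inj (g : gidx C) F1 F2 p q :
  gdom (glue g) F1 -> gdom (glue g) F2 -> carrier F1 p -> carrier F2 q ->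
  gmap (glue g) p = gmap (glue g) q -> p = q.
Proof.
move=> g1 g2 p1 q2 e; have [h [[_ inj _] _ _ _]] := gmap_homeo (glue g).
by apply: (inj p q _ _ e); apply/mem_set; [exists F1 | exists F2].
Qed.

Lemma gdom_facet (g : gidx C) F : gdom (glue g) F -> facets (cell (gsrc g)) F.
Proof. exact: gdom_facets. Qed.

Lemma gdom_brick (g : gidx C) F : gdom (glue g) F -> is_brick R F.
Proof. by move=> gF; exact: brick_facet (cell_brick _) (gdom_facet gF). Qed.

Lemma gran_facet (g : gidx C) F : gdom (glue g) F ->
  facets (cell (gtgt g)) (bimage (gmap (glue g)) F).
Proof. by move=> gF; apply: (@gran_facets _ _ _ _ _ (glue g)); exists F. Qed.

Lemma gmap_interior (g : gidx C) F p : gdom (glue g) F -> carrier F p ->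
  brick_interior (bimage (gmap (glue g)) F) (gmap (glue g) p) <->
  brick_interior F p.
Proof.
move=> gF Fp; rewrite /brick_interior carrier_bimage facets_bimage.
split=> -[_ np]; split => //; try by exists p.
  move=> [G FG Gp]; apply: np; exists (bimage (gmap (glue g)) G).
    by exists G.
  by rewrite carrier_bimage; exists p.
move=> [_ [G FG <-]]; rewrite carrier_bimage => -[q Gq e]; apply: np.
exists G => //; suff <- : q = p by [].
apply: (gmap_inj gF gF _ Fp e).
exact: facet_carrier (gdom_brick gF) FG _ Gq.
Qed.

(** An interior point of a facet determines the facet together with its brick;
    the equality is stated in the disjoint union so that the two bricks may be
    given by different expressions. *)
Lemma same_facet (i i' : brick C) F F' p p' :
  facets (cell i) F -> facets (cell i') F' ->
  brick_interior F p -> carrier F' p' -> pt i p = pt i' p' ->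
  fc i F = fc i' F' /\ brick_interior F' p'.
Proof.
move=> TF TF' Fp Fp' e; have ei : i = i' by exact: (congr1 (@projT1 _ _) e).
subst i'; have ep := sigT_inj e; subst p'.
by have <- := facet_interior_unique (cell_brick i) TF TF' Fp Fp'.
Qed.

Definition facet_point (x : {i : brick C & space i}) : Prop :=
  exists i F p, [/\ facets (cell i) F, brick_interior F p & x = pt i p].

Definition glued (x y : {i : brick C & space i}) : Prop :=
  exists (g : gidx C) F p, [/\ gdom (glue g) F, brick_interior F p,
    x = pt (gsrc g) p & y = pt (gtgt g) (gmap (glue g) p)].

Lemma attached_src (g : gidx C) F :
  gdom (glue g) F -> attached g (fc (gsrc g) F).
Proof. by move=> gF; left; exists F. Qed.

Lemma attached_tgt (g : gidx C) F : gdom (glue g) F ->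
  attached g (fc (gtgt g) (bimage (gmap (glue g)) F)).
Proof.
by move=> gF; right; exists (bimage (gmap (glue g)) F) => //; exists F.
Qed.

Lemma glued_points x y : glued x y -> facet_point x /\ facet_point y.
Proof.
move=> [g [F [p [gF Fp -> ->]]]]; split.
  by exists (gsrc g), F, p; split => //; exact: gdom_facet.
exists (gtgt g), (bimage (gmap (glue g)) F), (gmap (glue g) p).
split => //; first exact: gran_facet.
by apply/gmap_interior => //; case: Fp.
Qed.

Lemma identified_src x y : facet_point x -> identified x y -> glued x y.
Proof.
move=> [i [F [p [TF Fp ->]]]] [g [q [[F' gF' F'q] e ->]]].
have [_ F'qi] := same_facet TF (gdom_facet gF') Fp F'q e.
by exists g, F', q.
Qed.

Lemma identified_tgt x y : facet_point y -> identified x y -> glued x y.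
Proof.
move=> [i [F [p [TF Fp ->]]]] [g [q [[F' gF' F'q] -> e]]].
have cq : carrier (bimage (gmap (glue g)) F') (gmap (glue g) q).
  by rewrite carrier_bimage; exists q.
have [_ F'qi] := same_facet TF (gran_facet gF') Fp cq e.
by exists g, F', q; split => //; apply/(gmap_interior gF' F'q).
Qed.

Lemma glued_fun x y z : glued x y -> glued x z -> y = z.
Proof.
move=> [g [F [p [gF Fp -> ->]]]] [g' [F' [p' [gF' Fp' e ->]]]].
have [eF _] := same_facet (gdom_facet gF) (gdom_facet gF') Fp (proj1 Fp') e.
have eg : g = g'.
  apply: attached_inj (attached_src gF) _; rewrite eF; exact: attached_src.
by subst g'; rewrite (sigT_inj e).
Qed.

Lemma glued_inj x y z : glued x z -> glued y z -> x = y.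
Proof.
move=> [g [F [p [gF Fp -> ->]]]] [g' [F' [p' [gF' Fp' -> e]]]].
have b := proj2 (gmap_interior gF (proj1 Fp)) Fp.
have b' := proj2 (gmap_interior gF' (proj1 Fp')) Fp'.
have [eF _] := same_facet (gran_facet gF) (gran_facet gF') b (proj1 b') e.
have eg : g = g'.
  apply: attached_inj (attached_tgt gF) _; rewrite eF; exact: attached_tgt.
subst g'; have epp := sigT_inj e; congr existT.
exact: (gmap_inj gF gF' (proj1 Fp) (proj1 Fp') epp).
Qed.

(** Two consecutive gluings would have the same facet attached to both, hence
    would be the same gluing map, whose source and target bricks differ. *)
Lemma glued_not_composable x y z : glued x y -> ~ glued y z.
Proof.
move=> [g [F [p [gF Fp _ ->]]]] [g' [F' [p' [gF' Fp' e _]]]].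
have b := proj2 (gmap_interior gF (proj1 Fp)) Fp.
have [eF _] := same_facet (gran_facet gF) (gdom_facet gF') b (proj1 Fp') e.
have eg : g = g'.
  apply: attached_inj (attached_tgt gF) _; rewrite eF; exact: attached_src.
subst g'; apply: (@gsrc_neq_gtgt _ _ _ C g).
exact: esym (congr1 (@projT1 _ _) e).
Qed.

(** By the three preceding lemmas, the relation on the right is closed under
    composition at facet points, so it contains the generated equivalence. *)
Lemma facet_point_class x y : facet_point x -> proj x = proj y ->
  [\/ x = y, glued x y | glued y x].
Proof.
move=> fx /proj_fibers xy.
suff [_ h] : (facet_point x <-> facet_point y) /\
    (facet_point x -> [\/ x = y, glued x y | glued y x]) by exact: h.
elim: xy {fx} => {x y} [x y xy|x|x y _ [e h]|x y z _ [e1 h1] _ [e2 h2]].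
- have h : facet_point x \/ facet_point y -> glued x y.
    by case=> f; [exact: identified_src | exact: identified_tgt].
  split; last by move=> f; apply: Or32; apply: h; left.
  by split=> f; [have [] := glued_points (h (or_introl f))
               | have [] := glued_points (h (or_intror f))].
- by split => // _; apply: Or31.
- split; first by rewrite e.
  by move=> /e /h [->|g|g]; [apply: Or31|apply: Or33|apply: Or32].
- split; first by rewrite e1.
  move=> f; have [->|g1|g1] := h1 f.
  + exact: h2 (proj1 e1 f).
  + have [<-|g2|g2] := h2 (proj1 e1 f); first exact: Or32.
    * by case: (glued_not_composable g1 g2).
    * by apply: Or31; exact: glued_inj g1 g2.
  + have [<-|g2|g2] := h2 (proj1 e1 f); first exact: Or33.
    * by apply: Or31; exact: glued_fun g1 g2.
    * by case: (glued_not_composable g2 g1).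
Qed.

(** The class of an interior point meets each brick at most once, since a gluing
    map joins distinct bricks. *)
Lemma image_in_inj (i : brick C) F1 F2 :
  facets (cell i) F1 -> facets (cell i) F2 ->
  image_in (carrier F1) = image_in (carrier F2) -> F1 = F2.
Proof.
move=> T1 T2 e.
have [p Fp] := brick_interior_nonempty (brick_facet (cell_brick i) T1).
have : image_in (carrier F2) (proj (pt i p)) by rewrite -e; exists p => //;
case: Fp.
move=> [q F2q eq].
have fp : facet_point (pt i p) by exists i, F1, p.
have ne (x y : {i : brick C & space i}) : projT1 x = projT1 y -> ~ glued x y.
  move=> exy [g [F [r [_ _ ex ey]]]]; apply: (@gsrc_neq_gtgt _ _ _ C g).
  by move: exy; rewrite ex ey.
have [E|/ne|/ne] := facet_point_class fp (esym eq); try by case.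
have epq := sigT_inj E; subst q.
exact: facet_interior_unique (cell_brick i) T1 T2 Fp F2q.
Qed.

Definition glued_facets (x y : {i : brick C & bdata (space i) n.-1}) : Prop :=
  exists (g : gidx C) F, [/\ gdom (glue g) F, x = fc (gsrc g) F &
    y = fc (gtgt g) (bimage (gmap (glue g)) F)].

Lemma same_image_glued (A B : brick C) F1 F2 : A <> B ->
  facets (cell A) F1 -> facets (cell B) F2 ->
  image_in (carrier F1) = image_in (carrier F2) ->
  glued_facets (fc A F1) (fc B F2) \/ glued_facets (fc B F2) (fc A F1).
Proof.
move=> AB T1 T2 e.
have [p Fp] := brick_interior_nonempty (brick_facet (cell_brick A) T1).
have : image_in (carrier F2) (proj (pt A p)) by rewrite -e; exists p => //;
case: Fp.
move=> [q F2q eq].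
have fp : facet_point (pt A p) by exists A, F1, p.
have [E|G|G] := facet_point_class fp (esym eq).
- by case: AB; exact: (congr1 (@projT1 _ _) E).
- case: G => g [F [r [gF Fr ea eb]]]; left; exists g, F.
  have [-> _] := same_facet T1 (gdom_facet gF) Fp (proj1 Fr) ea.
  have b := proj2 (gmap_interior gF (proj1 Fr)) Fr.
  by have [-> _] := same_facet (gran_facet gF) T2 b F2q (esym eb).
- case: G => g [F [r [gF Fr eb ea]]]; right; exists g, F.
  have b := proj2 (gmap_interior gF (proj1 Fr)) Fr.
  have [-> _] := same_facet (gran_facet gF) T1 b (proj1 Fp) (esym ea).
  by have [-> _] := same_facet (gdom_facet gF) T2 Fr F2q (esym eb).
Qed.

Lemma glued_facets_attached x y : glued_facets x y ->
  exists g : gidx C, [/\ attached g x, attached g y &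
    projT1 x = gsrc g /\ projT1 y = gtgt g].
Proof.
move=> [g [F [gF -> ->]]]; exists g; split => //.
  exact: attached_src.
exact: attached_tgt.
Qed.

(** The gluing map that joins [A] to [B] and the one that joins [A] to [D] are
    attached to the same facet of [A], hence coincide. *)
Lemma facet_two_bricks (A B D : brick C) (F : set M) :
  brick_facets A F -> brick_facets B F -> brick_facets D F ->
  A <> B -> A <> D -> B = D.
Proof.
move=> [F1 T1 e1] [F2 T2 e2] [F3 T3 e3] AB AD.
have h (E E' : brick C) G G' : glued_facets (fc E G) (fc E' G') \/
    glued_facets (fc E' G') (fc E G) -> exists g : gidx C, attached g (fc E G) /\
    ((E = gsrc g /\ E' = gtgt g) \/ (E = gtgt g /\ E' = gsrc g)).
  by case=> /glued_facets_attached [g [a1 a2 [x y]]]; exists g; split; tauto.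
have e12 : image_in (carrier F1) = image_in (carrier F2) by rewrite e1 e2.
have e13 : image_in (carrier F1) = image_in (carrier F3) by rewrite e1 e3.
have [g [ag hg]] := h _ _ _ _ (same_image_glued AB T1 T2 e12).
have [g' [ag' hg']] := h _ _ _ _ (same_image_glued AD T1 T3 e13).
have eg := attached_inj ag ag'; subst g'.
have := @gsrc_neq_gtgt _ _ _ C g.
by case: hg hg' => -[-> ->] [] [x ->] // => ne; case: ne; rewrite -x.
Qed.

End Identification.

(** * Parity of multiplicities *)

(** Cardinals of sets are turned into counts over a fixed enumeration, where
    sums can be exchanged. *)
Lemma count_mem_card (T : choiceType) (S : set T) (r : seq T) (k : nat) :
  uniq r -> S `<=` [set` r] -> (S #= `I_k)%card ->
  count (fun x => x \in S) r = k.
Proof.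
move=> ur Sr Sk; have Sfin : finite_set S by apply/finite_setP; exists k.
rewrite -(card_fset_set Sk) -size_filter; apply/perm_size/uniq_perm.
- exact: filter_uniq.
- exact: finmap.fset_uniq.
- move=> x; rewrite mem_filter in_fset_set //.
  by apply: andb_idr; rewrite inE => /Sr.
Qed.

(** Double counting of the pairs [(t, u)] with [Q t u] and [Z u]: each [u]
    contributes two of them. *)
Lemma even_incidences (T U : choiceType) (P : set T) (Q : T -> set U)
    (Z : set U) (c : T -> nat) :
  finite_set P -> (forall t, P t -> finite_set (Q t)) ->
  (forall u, (exists2 t, P t & Q t u) ->
     ([set t | P t /\ Q t u] #= `I_2)%card) ->
  (forall t, P t -> ([set u | Q t u /\ Z u] #= `I_(c t))%card) ->
  ~~ odd (\sum_(t \in P) c t).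
Proof.
move=> Pfin Qfin Q2 Qc.
have Ufin : finite_set (\bigcup_(t in P) Q t) by exact: bigcup_finite.
set rU := fset_set (\bigcup_(t in P) Q t).
rewrite fsbig_finite //.
have inP t : t \in (fset_set P : seq T) -> P t by rewrite in_fset_set // inE.
have -> : (\sum_(t <- fset_set P) c t =
    \sum_(u <- rU | u \in Z) \sum_(t <- fset_set P) (u \in Q t))%N.
  rewrite exchange_big /=; apply: eq_big_seq => t /inP Pt.
  rewrite -(@count_mem_card _ _ rU _ _ _ (Qc t Pt)) //.
  - rewrite -sum1_count big_mkcond [RHS]big_mkcond /=; apply: eq_bigr => u _.
    rewrite -[X in if X then _ else _]/(u \in [set u | Q t u /\ Z u]).
    have -> : (u \in [set u | Q t u /\ Z u]) = (u \in Q t) && (u \in Z).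
      by apply/idP/andP; rewrite !inE.
    by case: (u \in Q t); case: (u \in Z).
  - by move=> u [Qu _] /=; rewrite /rU in_fset_set // inE; exists t.
rewrite -dvdn2 big_seq_cond; apply: dvdn_sum => u /andP[uU _].
have [t Pt Qt] : (\bigcup_(t in P) Q t) u.
  by move: uU; rewrite in_fset_set // inE.
suff -> : (\sum_(t <- fset_set P) (u \in Q t) = 2)%N by [].
rewrite -(@count_mem_card _ _ (fset_set P) _ _ _ (Q2 u (ex_intro2 _ _ t Pt Qt))) //.
  rewrite -sum1_count [RHS]big_mkcond /=; apply: eq_big_seq => s /inP Ps.
  have -> : (s \in [set s | P s /\ Q s u]) = (u \in Q s).
    by apply/idP/idP; rewrite !inE => // -[].
  by case: (u \in Q s).
by move=> s [Ps _] /=; rewrite in_fset_set // inE.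
Qed.

Section Complex.
Variables (R : realType) (n : nat) (M : topologicalType).
Variable C : brick_complex R n M.

Lemma finite_brick_facets (A : brick C) : finite_set (brick_facets A).
Proof. by apply: finite_image; exact: finite_facets (cell_brick A). Qed.

Lemma finite_complex_facets : finite_set (complex_facets C).
Proof.
by apply: bigcup_finite; [exact: finite_finset|move=> A _;
  exact: finite_brick_facets].
Qed.

Definition subfaces_onto (alpha : set M) (A : brick C)
    (F : bdata (space A) n.-1) : set (bdata (space A) n.-1.-1) :=
  [set G | facets F G /\ image_in (carrier G) = alpha].

Lemma image_in_glued (g : gidx C) (S : set (space (gsrc g))) :
  S `<=` \bigcup_(F in gdom (glue g)) carrier F ->
  image_in (gmap (glue g) @` S) = image_in S.
Proof.
move=> Sd; rewrite /image_in image_comp; apply: eq_imagel => p Sp /=.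
apply/esym/proj_fibers/rst_step; exists g, p; split => //; exact: Sd.
Qed.

Lemma card_subfaces_glued alpha (g : gidx C) F : gdom (glue g) F ->
  (subfaces_onto alpha (bimage (gmap (glue g)) F) #= subfaces_onto alpha F)%card.
Proof.
move=> gF; have bF := gdom_brick gF.
have Gd G : facets F G -> carrier G `<=` \bigcup_(F in gdom (glue g)) carrier F.
  by move=> FG x Gx; exists F => //; exact: facet_carrier bF FG _ Gx.
have -> : subfaces_onto alpha (bimage (gmap (glue g)) F) =
    bimage (gmap (glue g)) @` subfaces_onto alpha F.
  rewrite /subfaces_onto facets_bimage; apply/seteqP;
  split => [_ [[G FG <-]]|_ [G [FG e] <-]].
    by rewrite carrier_bimage image_in_glued; [exists G | exact: Gd].
  split; first by exists G.
  by rewrite carrier_bimage image_in_glued //; exact: Gd.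
apply: inj_card_eq => G H; rewrite !inE => -[FG _] [FH _] e.
have [h [_ hK _ _]] := gmap_homeo (glue g).
rewrite -(bimageK hK (brick_facet bF FG) (Gd _ FG)) e.
by rewrite (bimageK hK (brick_facet bF FH) (Gd _ FH)).
Qed.

Lemma card_subfaces_same_image alpha (A B : brick C) F1 F2 :
  facets (cell A) F1 -> facets (cell B) F2 ->
  image_in (carrier F1) = image_in (carrier F2) ->
  (subfaces_onto alpha F1 #= subfaces_onto alpha F2)%card.
Proof.
move=> T1 T2 e; have [AB|AB] := pselect (A = B).
  by subst B; rewrite (image_in_inj T1 T2 e).
have h x y : glued_facets x y ->
    (subfaces_onto alpha (projT2 x) #= subfaces_onto alpha (projT2 y))%card.
  by move=> [g [F [gF -> ->]]] /=; rewrite card_eq_sym;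
    exact: card_subfaces_glued.
by case: (same_image_glued AB T1 T2 e) => /h //=; rewrite card_eq_sym.
Qed.

(** The multiplicity is computed correctly by any brick and any of its facets
    with the given image, because gluing maps are bijective on faces. *)
Lemma multiplicityP alpha (A : brick C) F : facets (cell A) F ->
  (subfaces_onto alpha F #= `I_(multiplicity C alpha (image_in (carrier F))))%card.
Proof.
move=> TF; have : finite_set (subfaces_onto alpha F).
  apply: (sub_finite_set (B := facets F)); first by move=> G [].
  exact: finite_facets (brick_facet (cell_brick A) TF).
move=> /finite_setP[k Fk]; rewrite /multiplicity (xget_unique _ (x := k)) //.
  by exists A, F.
move=> l [B [F' [TF' e F'l]]]; apply/esym/card_eq_II.
apply: card_eq_trans F'l; rewrite card_eq_sym in Fk; apply: card_eq_trans Fk _.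
exact: card_subfaces_same_image.
Qed.

(** The boundary of a brick has no boundary: each face of codimension two lies
    in exactly two facets. Distinct facets have distinct images, so the sum over
    images counts them all. *)
Lemma even_multiplicity_brick alpha (A : brick C) :
  ~~ odd (\sum_(F \in brick_facets A) multiplicity C alpha F).
Proof.
rewrite /brick_facets.
have inj : set_inj (facets (cell A)) (fun F => image_in (carrier F) : set M).
  by move=> F1 F2; rewrite !inE; exact: image_in_inj.
(* Brick data carry no choice structure, hence the classical one. *)
rewrite (@fsbig_image _ _ _ {classic bdata (space A) n.-1} _ _ _ _ inj).
apply: (@even_incidences {classic bdata (space A) n.-1}
  {classic bdata (space A) n.-1.-1} (facets (cell A)) (@facets _ n.-1)
  [set G : bdata (space A) n.-1.-1 | image_in (carrier G) = alpha]
  (fun F => multiplicity C alpha (image_in (carrier F)))).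
- exact: finite_facets (cell_brick A).
- by move=> F TF; exact: finite_facets (brick_facet (cell_brick A) TF).
- by move=> G; exact: ridge_two_facets (cell_brick A).
- by move=> F TF; exact: multiplicityP.
Qed.

End Complex.

(** * Cuts *)

Lemma fsum_sub (V : nmodType) (T : choiceType) (D S : set T) (f : T -> V) :
  finite_set D -> S `<=` D ->
  \sum_(x \in S) f x = \sum_(x <- fset_set D) if x \in S then f x else 0.
Proof.
move=> Dfin SD; have -> : S = D `&` S by apply/esym/setIidPr.
rewrite fsbig_mkcondr fsbig_finite //; apply: eq_big_seq => x.
rewrite in_fset_set // inE => Dx; congr (if _ then _ else _).
by apply/idP/idP; rewrite !inE => // -[].
Qed.

Section Cuts.
Variables (R : realType) (T : finType) (W : T -> T -> R).
Hypothesis W_sym : forall A B, W A B = W B A.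
Hypothesis W_ge0 : forall A B, 0 <= W A B.
Implicit Types X Y : T -> bool.

(** [W A B] stands for the total weight of the edges joining [A] and [B], and
    [X] for the set of vertices on one side. *)
Definition cut X : R := \sum_(A | X A) \sum_(B | ~~ X B) W A B.

(** The change of the cut when [A] changes sides; the strength of a
    brick relative to a level set has this form. *)
Definition flow X A : R :=
  \sum_(B | B != A) if X A == X B then W A B else - W A B.

Lemma cut_remove X Y A : X A -> (forall B, Y B = X B && (B != A)) ->
  cut Y = cut X + flow X A.
Proof.
move=> XA YE; rewrite /cut (bigD1 A XA) /=.
have -> : \sum_(B | Y B) \sum_(D | ~~ Y D) W B D =
   \sum_(B | X B && (B != A)) (W B A + \sum_(D | ~~ X D) W B D).
  apply: eq_big => [B|B]; rewrite YE // => /andP[XB BA];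
  rewrite (bigD1 A) ?YE ?eqxx ?andbF //=.
  congr (_ + _); apply: eq_bigl => D; rewrite YE.
  by case: eqVneq => [->|_]; rewrite ?XA // andbT andbT.
rewrite big_split /=.
have -> : flow X A =
    \sum_(B | X B && (B != A)) W B A - \sum_(B | ~~ X B) W A B.
  rewrite /flow XA (bigID X) /= -sumrN; congr (_ + _).
    apply: eq_big => [B|B /andP[_ ->]]; first by rewrite andbC.
    exact: W_sym.
  apply: eq_big => [B|B /andP[_ /negbTE -> //]].
  by rewrite andb_idl //; apply: contraNneq => ->.
lra.
Qed.

(** This is the submodularity of cuts. *)
Lemma flow_mono X Y A : X A -> (forall B, X B -> Y B) ->
  flow X A <= flow Y A.
Proof.
move=> XA XY; rewrite /flow XA (XY _ XA); apply: ler_sum => B _.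
have := XY B; case: (X B) => [->//|_]; case: (Y B) => //=.
by have := W_ge0 A B; lra.
Qed.

(** The edges joining [A] and [B] pass from counting negatively to counting
    positively, hence the factor 2. *)
Lemma flow_add X Y A B : X A -> ~~ X B ->
  (forall D, Y D = X D || (D == B)) -> flow Y A = flow X A + 2 * W A B.
Proof.
move=> XA XB YE; have BA : B != A by apply: contraNneq XB => ->.
rewrite /flow !YE XA (bigD1 B) //= [in RHS](bigD1 B) //= YE eqxx orbT (negbTE XB) /=.
rewrite (eq_bigr (fun D => if true == X D then W A D else - W A D)); last first.
  by move=> D /andP[_ /negbTE DB]; rewrite YE DB orbF.
by rewrite -mulr_natl; lra.
Qed.

Lemma flow_flip X Y B : (forall D, Y D = X D (+) (D == B)) ->
  flow Y B = - flow X B.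
Proof.
move=> YE; rewrite /flow -sumrN; apply: eq_bigr => D /negbTE DB.
by rewrite !YE eqxx DB; case: (X B); case: (X D); rewrite /= ?opprK.
Qed.

End Cuts.

(** * Level sets *)

Section LevelSets.
Variables (R : realType) (n : nat) (M : topologicalType).
Variable C : brick_complex R n M.
Implicit Types (A B D : brick C) (O : brick C -> nat).

Lemma interior_facet_pair F : complex_facets C F -> ~ boundary_facets C F ->
  exists A B, [/\ A <> B, brick_facets A F & brick_facets B F].
Proof.
move=> [A _ AF] nb; apply: contrapT => h; apply: nb; exists A; split => // B BF.
by apply: contrapT => AB; apply: h; exists A, B.
Qed.

Lemma shared_facet_interior A B F : A <> B -> brick_facets A F ->
  brick_facets B F -> ~ boundary_facets C F.
Proof. by move=> AB AF BF [D [_ h]]; apply: AB; rewrite -(h A AF) (h B BF). Qed.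

(** As [A] and [B] are the only bricks that contain [F], the level set contains
    [F] exactly when it separates them. *)
Lemma level_setP O j A B F : A <> B -> brick_facets A F -> brick_facets B F ->
  (F \in level_set O j) = ((O A <= j)%N != (O B <= j)%N).
Proof.
move=> AB AF BF; apply/idP/idP; rewrite inE.
  move=> [D [E [Dj Ej DF EF]]].
  have DE : D <> E by move=> e; move: Dj; rewrite e leqNgt Ej.
  have [e|AD] := pselect (A = D).
    by subst D; rewrite (facet_two_bricks AF BF EF AB DE) Dj leqNgt Ej.
  have [e|AE] := pselect (A = E).
    subst E; rewrite (facet_two_bricks AF BF DF AB AD) Dj.
    by rewrite (leqNgt (O A)) Ej.
  case: DE; exact: facet_two_bricks AF DF EF AD AE.
case: (leqP (O A) j) => a; case: (leqP (O B) j) => b // _.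
  by exists A, B.
by exists B, A.
Qed.

Lemma level_set_complex O j : level_set O j `<=` complex_facets C.
Proof. by move=> F [A [_ [_ _ AF _]]]; exists A. Qed.

Lemma level_set_interior O j : level_set O j `&` boundary_facets C = set0.
Proof.
apply/seteqP; split => // F [[A [B [Aj Bj AF BF]]]].
apply: (@shared_facet_interior A B) => // e.
by move: Aj; rewrite e leqNgt Bj.
Qed.

Lemma multiplicity_eq0 alpha F : complex_facets C F ->
  ~ alpha `<=` F -> multiplicity C alpha F = 0%N.
Proof.
move=> [A _ [F' TF <-]] nalpha; have := multiplicityP alpha TF.
suff -> : subfaces_onto alpha F' = set0.
  rewrite card_eq_sym card_eq0 => /eqP; rewrite -II0 => e.
  by apply/card_eq_II; rewrite e.
apply/seteqP; split => // G [FG e]; apply: nalpha; rewrite -e.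
apply: image_subset; exact: facet_carrier (brick_facet (cell_brick A) TF) FG.
Qed.

(** Modulo 2, summing the even contributions of the bricks up to level [j]
    cancels the facets that lie in two of these bricks and leaves those of the
    level set. A boundary facet would be counted once as well, but it does not
    contain [alpha]. *)
Lemma level_set_even O j alpha :
  ~ alpha `<=` \bigcup_(F in boundary_facets C) F ->
  ~~ odd (\sum_(F \in level_set O j) multiplicity C alpha F).
Proof.
move=> nb; pose m := multiplicity C alpha.
have cf := finite_complex_facets C.
pose below := (\sum_(A | (O A <= j)%N) \sum_(F \in brick_facets A) m F)%R.
have below_even : ~~ odd below.
  rewrite -dvdn2; apply: dvdn_sum => A _; rewrite dvdn2.
  exact: even_multiplicity_brick.
suff -> : odd (\sum_(F \in level_set O j) m F) = odd below by [].
rewrite (fsum_sub _ cf (@level_set_complex O j)).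
have -> : below = \sum_(F <- fset_set (complex_facets C))
    \sum_(A | (O A <= j)%N) if F \in brick_facets A then m F else 0.
  rewrite exchange_big /=; apply: eq_bigr => A _.
  by apply: fsum_sub => // F AF; exists A.
rewrite !(big_morph odd oddD (erefl _)); apply: eq_big_seq => F.
rewrite in_fset_set // inE => CF.
have [m0|m0] := eqVneq (m F) 0%N.
  by rewrite m0 if_same big1 // => A _; rewrite if_same.
have [|A [B [AB AF BF]]] := interior_facet_pair CF.
  move=> bF; move/eqP: m0; apply; apply: multiplicity_eq0 => // aF; apply: nb.
  by apply: subset_trans aF _; exact: bigcup_sup.
rewrite (level_setP _ _ AB AF BF) big_mkcond (bigD1 A) //= (bigD1 B) /=;
last first.
  by apply/eqP => e; apply: AB.
rewrite (mem_set AF) (mem_set BF) big1 ?addr0.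
  case: (O A <= j)%N; case: (O B <= j)%N; rewrite //= ?addr0 ?add0r //.
  exact: esym (etrans (oddD _ _) (addbb _)).
move=> D /andP[/eqP DA /eqP DB]; case: ifP => // _; case: ifP => //.
rewrite inE => DF; case: DB; apply: esym; apply: (facet_two_bricks AF BF DF AB).
by move=> e; apply: DA.
Qed.

Lemma level_set_proper O j : proper_surface C (level_set O j).
Proof.
split; [exact: level_set_complex | exact: level_set_interior |].
by move=> alpha _; exact: level_set_even.
Qed.

Variable w : set M -> R.

(** The weight of an edge of the dual graph of the complex. *)
Definition shared_weight A B : R := weight w (brick_facets A `&` brick_facets B).

Lemma shared_weight_sym A B : shared_weight A B = shared_weight B A.
Proof. by rewrite /shared_weight setIC. Qed.

Lemma weight_disjoint_union (P : pred (brick C)) (S : brick C -> set (set M)) :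
  (forall B, S B `<=` complex_facets C) ->
  (forall B D F, P B -> P D -> S B F -> S D F -> B = D) ->
  weight w [set F | exists2 B, P B & S B F] = \sum_(B | P B) weight w (S B).
Proof.
move=> SC dis; have cf := finite_complex_facets C.
rewrite /weight (@fsum_sub _ _ (complex_facets C)) //; last first.
  by move=> F [B _]; exact: SC.
under [RHS]eq_bigr => B _ do rewrite (fsum_sub _ cf (SC B)).
rewrite exchange_big /=; apply: eq_bigr => F _; case: ifPn.
  rewrite inE => -[B PB SB];
  rewrite (bigD1 B PB) /= (mem_set SB) big1 ?addr0 //.
  move=> D /andP[PD /eqP DB]; case: ifP => //; rewrite inE => SD.
  by case: DB; exact: dis SD SB.
move=> nS; rewrite big1 // => B PB; case: ifP => //; rewrite inE => SB.
by case/negP: nS; rewrite inE; exists B.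
Qed.

Lemma weight_shared A (P : pred (brick C)) : ~~ P A ->
  weight w [set F | exists2 B, P B & (brick_facets A `&` brick_facets B) F] =
  \sum_(B | P B) shared_weight A B.
Proof.
move=> PA; apply: weight_disjoint_union => [B F [AF _]|B D F PB PD [AF BF] [_ DF]].
  by exists A.
by apply: (facet_two_bricks AF BF DF) => e; move: PA; rewrite e ?PB ?PD.
Qed.

Lemma level_weight_cut O j :
  level_weight w O j = cut shared_weight (fun A => (O A <= j)%N).
Proof.
rewrite /level_weight /cut.
pose S A := [set F | exists2 B, ~~ (O B <= j)%N & (brick_facets A `&` brick_facets B) F].
have -> : level_set O j = [set F | exists2 A, (O A <= j)%N & S A F].
  apply/seteqP; split => F.
    by move=> [A [B [Aj Bj AF BF]]]; exists A => //; exists B => //;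
      rewrite -ltnNge.
  by move=> [A Aj [B Bj [AF BF]]]; exists A, B; split => //; rewrite ltnNge.
rewrite weight_disjoint_union.
- by apply: eq_bigr => A Aj; apply: weight_shared; rewrite negbK.
- by move=> A F [B _ [AF _]]; exists A.
- move=> A D F Aj Dj [B Bj [AF BF]] [_ _ [DF _]].
  apply: contrapT => AD.
  have AB : A <> B by move=> e; rewrite -e Aj in Bj.
  by move: Bj; rewrite (facet_two_bricks AF BF DF AB AD) Dj.
Qed.

Lemma strength_flow O j A :
  strength w (level_set O j) A = flow shared_weight (fun B => (O B <= j)%N) A.
Proof.
rewrite /strength /flow (bigID (fun B => (O A <= j)%N == (O B <= j)%N)) /=.
have E (b : bool) (S : set (set M)) :
    (forall F, S F <-> [/\ brick_facets A F, ~ boundary_facets C F &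
       (F \in level_set O j) = b]) ->
    weight w S = \sum_(B | (B != A) && (((O A <= j)%N == (O B <= j)%N) == ~~ b))
        shared_weight A B.
  move=> SE; rewrite -weight_shared ?eqxx //; congr weight.
  apply/seteqP; split => F.
    move=> /SE [AF nb Fb]; have [|D [E [DE DF EF]]] := interior_facet_pair _ nb.
      by exists A.
    have [B BA BF] : exists2 B, A <> B & brick_facets B F.
      by have [->|] := pselect (A = D); [exists E|exists D].
    exists B => //; apply/andP; split; first by apply/eqP => e; apply: BA.
    by rewrite -Fb (level_setP _ _ BA AF BF) negbK.
  move=> [B /andP[/eqP BA /eqP e] [AF BF]].
  have AB : A <> B by move=> e'; apply: BA.
  apply/SE; split => //; first exact: shared_facet_interior AB AF BF.
  by rewrite (level_setP _ _ AB AF BF) e negbK.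
congr (_ + _).
  rewrite (E false); last first.
    move=> F; split=> [[[AF nb] nF]|[AF nb nF]].
      by split => //; apply/negbTE/negP; rewrite inE.
    by split => // FS; rewrite (mem_set FS) in nF.
  by apply: eq_big => B; case: (_ == (O B <= j)%N); rewrite ?andbF.
rewrite (E true) -?sumrN; last first.
  move=> F; split=> [[[AF nb] nF]|[AF nb nF]].
    by split => //; exact: mem_set.
  by split => //; exact: set_mem nF.
by apply: eq_big => B; case: (_ == (O B <= j)%N); rewrite ?andbF.
Qed.

Lemma weight_ge0 (hw : weight_system C w) (S : set (set M)) :
  S `<=` complex_facets C -> 0 <= weight w S.
Proof.
move=> SC; rewrite /weight (fsum_sub _ (finite_complex_facets C) SC).
rewrite big_seq; apply: sumr_ge0 => F.
by rewrite in_fset_set ?inE; [move=> CF; case: ifP => // _;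
  exact: hw | exact: finite_complex_facets].
Qed.

Lemma shared_weight_ge0 (hw : weight_system C w) A B : 0 <= shared_weight A B.
Proof. by apply: weight_ge0 => // F [AF _]; exists A. Qed.

End LevelSets.

(** * Widths *)

(** The width depends on an ordering only through its profile of level
    weights. *)
Definition profile_width (R : realType) (N : nat) (L : nat -> R) : seqlexi R :=
  sort (fun x y : R => y <= x)
       [seq L t | t <- iota 1 N.-1 & `[< is_maximum N L t >]].

Section Lexicographic.
Variable R : realType.
Implicit Types (s u v : seq R) (b : R).

Let gtr : rel R := fun x y => y <= x.

Let gtr_total : total gtr. Proof. exact: ge_total. Qed.
Let gtr_trans : transitive gtr. Proof. exact: ge_trans. Qed.
Let gtr_anti : antisymmetric gtr. Proof. exact: ge_anti. Qed.

Lemma sorted_head_ge u y x : sorted gtr (y :: u) -> x \in y :: u -> x <= y.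
Proof.
rewrite /= (path_sortedE gtr_trans) => /andP[/allP h _].
by rewrite inE => /predU1P[->//|/h].
Qed.

Lemma lexi_submultiset u u' : sorted gtr u -> sorted gtr u' ->
  (forall x, (count_mem x u' <= count_mem x u)%N) ->
  ((u' : seqlexi R) <= (u : seqlexi R))%O.
Proof.
elim: u u' => [|y u IH] [|x u'] su su' h; rewrite ?lexi0s //.
  by have := h x; rewrite /= eqxx.
have xu : x \in y :: u.
  by rewrite -has_pred1 has_count; apply: leq_trans (h x); rewrite /= eqxx.
have xy := sorted_head_ge su xu.
rewrite lexi_cons xy /=; apply/implyP => yx.
have e : x = y by apply: le_anti; rewrite xy.
apply: IH (path_sorted su) (path_sorted su') _ => z.
by have := h z; rewrite /= e leq_add2l.
Qed.

(** Compare entry by entry: at the first difference the submultiset has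
    the smaller entry, or it has ended and what follows is less than [b]. *)
Lemma lexi_proper_submultiset b u u' v v' : sorted gtr u -> sorted gtr u' ->
  (forall x, (count_mem x u' <= count_mem x u)%N) -> (size u' < size u)%N ->
  all (fun x => b <= x) u -> all (fun x => x < b) v' ->
  ((u' ++ v' : seqlexi R) < (u ++ v : seqlexi R))%O.
Proof.
move=> + + + + + v'b; elim: u u' => [|y u IH] [|x u'] su su' h // sz bu.
  clear IH; case: v' v'b => [|z v'] //= /andP[zb _]; rewrite ?ltxi0s //.
  move: bu => /= /andP[yb _]; have zy : z < y by exact: lt_le_trans zb yb.
  by rewrite neqhead_ltxiE // (lt_eqF zy).
have xu : x \in y :: u.
  by rewrite -has_pred1 has_count; apply: leq_trans (h x); rewrite /= eqxx.
have xy := sorted_head_ge su xu.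
rewrite /= ltxi_cons xy /=; apply/implyP => yx.
have e : x = y by apply: le_anti; rewrite xy.
apply: IH (path_sorted su) (path_sorted su') _ _ _ => // [z|].
  by have := h z; rewrite /= e leq_add2l.
by case/andP: bu.
Qed.

Lemma sort_filter_cat b s :
  sort gtr s = sort gtr [seq x <- s | b <= x]
               ++ sort gtr [seq x <- s | x < b].
Proof.
apply: (sorted_eq gtr_trans gtr_anti).
- exact: sort_sorted.
- rewrite sorted_pairwise // pairwise_cat -!sorted_pairwise //.
  rewrite !sort_sorted // !andbT.
  apply/allrelP => x y;
  rewrite !mem_sort !mem_filter => /andP[bx _] /andP[yb _].
  by rewrite /gtr; apply: ltW; exact: lt_le_trans yb bx.
- rewrite perm_sort.
  apply: (@perm_trans _ ([seq x <- s | b <= x] ++ [seq x <- s | x < b])).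
    rewrite perm_sym; have /permPl := perm_filterC (fun x => b <= x) s.
    rewrite (@eq_filter _ (fun x => x < b) (predC (fun x => b <= x))) //.
    by move=> x; rewrite /= ltNge.
  by apply: perm_cat; rewrite perm_sym perm_sort.
Qed.

Lemma sort_lexi_le s s' : (forall x, (count_mem x s' <= count_mem x s)%N) ->
  ((sort gtr s' : seqlexi R) <= (sort gtr s : seqlexi R))%O.
Proof.
move=> h; apply: lexi_submultiset; rewrite ?sort_sorted // => x.
have /permP -> := permEl (perm_sort gtr s').
by have /permP -> := permEl (perm_sort gtr s).
Qed.

(** Entries less than [b] come last, so they may increase freely once an entry
    that is at least [b] has been lost. *)
Lemma sort_lexi_lt b s s' :
  (forall x, b <= x -> (count_mem x s' <= count_mem x s)%N) ->
  (count (fun x => (b <= x)%R) s' < count (fun x => (b <= x)%R) s)%N ->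
  ((sort gtr s' : seqlexi R) < (sort gtr s : seqlexi R))%O.
Proof.
move=> h sz; rewrite (sort_filter_cat b s') (sort_filter_cat b s).
apply: (@lexi_proper_submultiset b); rewrite ?sort_sorted //.
- move=> x; have /permP -> := permEl (perm_sort gtr [seq x <- s' | b <= x]).
  have /permP -> := permEl (perm_sort gtr [seq x <- s | b <= x]).
  rewrite !count_filter; case: (lerP b x) => bx; last first.
    rewrite (@eq_count _ _ pred0) ?count_pred0 // => z /=.
    by case: eqP => //= ->; rewrite leNgt bx.
  rewrite !(@eq_count _ (predI (pred1 x) _) (pred1 x)) ?h //; move=> z /=;
    by case: eqP => //= ->; rewrite bx.
- by rewrite !size_sort !size_filter.
- by apply/allP => x; rewrite mem_sort mem_filter => /andP[].
- by apply/allP => x; rewrite mem_sort mem_filter => /andP[].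
Qed.

Lemma count_map_filter (P : pred R) (p : pred nat) (f : nat -> R) (r : seq nat) :
  count P [seq f t | t <- r & p t] = count (fun t => p t && P (f t)) r.
Proof.
by rewrite count_map count_filter; apply: eq_count => t /=; rewrite andbC.
Qed.

Variable N : nat.
Implicit Types f : nat -> R.

Lemma profile_width_le f f' :
  (forall t, is_maximum N f' t -> is_maximum N f t /\ f t = f' t) ->
  (profile_width N f' <= profile_width N f)%O.
Proof.
move=> h; apply: sort_lexi_le => x; rewrite !count_map_filter.
apply: sub_count => t /andP[/asboolP /h [m e] /= xe].
by rewrite e xe andbT; apply/asboolP.
Qed.

Lemma profile_width_lt f f' k : is_maximum N f k ->
  (forall t, is_maximum N f' t -> f k <= f' t ->
     [/\ is_maximum N f t, f t = f' t & t <> k]) ->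
  (profile_width N f' < profile_width N f)%O.
Proof.
move=> mk h; apply: (@sort_lexi_lt (f k)) => [x kx|]; rewrite !count_map_filter.
  apply: sub_count => t /andP[/asboolP m /= /eqP xe].
  have [|m' e _] := h t m; first by rewrite xe.
  by rewrite e xe eqxx andbT; apply/asboolP.
have kr : k \in iota 1 N.-1.
  by case: mk => tm [tp] [[/andP[h1 h2] _ _ _] _ _];
    rewrite mem_iota add1n ltnS h1.
have mk' : `[< is_maximum N f k >] by apply/asboolP.
set p := fun t => _ && (f k <= f t); set p' := fun t => _ && _.
have pk : p k by rewrite /p mk' lexx.
rewrite -!size_filter.
have -> : size [seq t <- iota 1 N.-1 | p t] =
   (count (pred1 k) [seq t <- iota 1 N.-1 | p t] +
    count (predC (pred1 k)) [seq t <- iota 1 N.-1 | p t])%N.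
  by rewrite count_predC.
rewrite count_uniq_mem ?filter_uniq ?iota_uniq // mem_filter pk kr add1n ltnS.
rewrite size_filter count_filter; apply: sub_count => t /andP[/asboolP m l] /=.
have [m' e tk] := h t m l.
by apply/andP; split; [apply/eqP | rewrite /p e l andbT; apply/asboolP].
Qed.

Section OneValue.
Variables (f f' : nat -> R) (k : nat).
Hypothesis k_range : (1 <= k <= N.-1)%N.
Hypothesis f'E : forall t, t <> k -> f' t = f t.

Let f'Ek t : (t < k)%N || (k < t)%N -> f' t = f t.
Proof. by move=> h; apply: f'E; lia. Qed.

Lemma maximum_away_from_change t tm tp : plateau N f' t tm tp ->
  f' tm < f' tm.+1 -> f' tp < f' tp.-1 -> (k < tm)%N || (tp < k)%N ->
  is_maximum N f t.
Proof.
move=> [h1 h2 h3 h4] l r h; exists tm, tp.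
have E (s : nat) : (tm <= s <= tp)%N -> f' s = f s by move=> ?; apply: f'Ek;
lia.
split; [split=> // s hs | |]; rewrite -?E; try lia; by [|exact: h4].
Qed.

(** Lowering the value at a maximum can create maxima, but only with values less
    than the old one: a plateau of the new profile at height [f k] or above
    that borders [k] starts at [k.+1], because [f k.-1 < f k], and it is already
    a maximum of [f], where [k] may belong to it as well. *)
Lemma width_lt_of_lowered_maximum : is_maximum N f k ->
  f k.-1 < f k -> f' k < f k ->
  (profile_width N f' < profile_width N f)%O.
Proof.
move=> mk ab xb; apply: (profile_width_lt mk) => t [tm [tp [pl l r]]] bv.
have tk : t <> k by move=> e; move: bv; rewrite e leNgt xb.
split=> //; last by rewrite f'E.
have [h|] := boolP ((k < tm)%N || (tp < k)%N).
  exact: maximum_away_from_change pl l r h.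
rewrite negb_or -!leqNgt => /andP[tmk ktp].
case: (pl) => h1 h2 h3 h4.
have vb : f' t = f t by rewrite f'E.
have [e|ntm] := eqVneq tm k.
  subst tm.
  have ek : f k.+1 = f' t.
    rewrite -(f'E (_ : k.+1 <> k)); last lia.
    by have [e'|] := eqVneq t k.+1; [rewrite e'|move=> ?; rewrite (h4 k.+1) //;
      lia].
  have [lt|ge] := ltrP (f k) (f' t).
    exists k, tp; split; [split=> // s hs | by rewrite ek |].
      by rewrite -vb (h4 s) // f'E //; lia.
    by move: r; rewrite !f'E //; lia.
  have eqb : f k = f' t by apply: le_anti; rewrite bv ge.
  (* At equal height, the plateau of f starts at k instead of k.+1. *)
  exists k.-1, tp; split; [split; first lia; first lia; first lia| |].
  - move=> s hs; have [->|ns] := eqVneq s k; first by rewrite -vb eqb.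
    by rewrite -vb (h4 s) // ?f'E //; [apply/eqP | lia].
  - by rewrite prednK //; lia.
  - by move: r; rewrite !f'E //; lia.
have [e|ntp] := eqVneq tp k.
  have ek : f k.-1 = f' t.
    rewrite -(f'E (_ : k.-1 <> k)); last lia.
    by rewrite (h4 k.-1) //; lia.
  by move: ab; rewrite ek ltNge bv.
by move: bv; rewrite (h4 k) ?leNgt ?xb //; lia.
Qed.

(** If [k] is a maximum, it is lowered. Otherwise the profile continues upwards
    after [k], and the third hypothesis keeps the new value at least [f k.-1]:
    the profile still ascends through [k] and no maximum appears. *)
Lemma width_le_of_ascent :
  f k.-1 < f k -> f' k < f k.+1 -> f k.-1 + f k.+1 <= f k + f' k ->
  (profile_width N f' <= profile_width N f)%O.
Proof.
move=> ab xc sub; have [mk|nmk] := pselect (is_maximum N f k).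
  apply/ltW/width_lt_of_lowered_maximum => //; apply: (lt_le_trans xc).
  case: mk => tm [tp [[h1 h2 h3 h4] l r]].
  have [e|n] := eqVneq tp k.+1; first by move: r; rewrite e /= => /ltW.
  by rewrite (h4 k.+1) //; lia.
have bc : f k <= f k.+1.
  rewrite leNgt; apply/negP => cb; apply: nmk; exists k.-1, k.+1.
  split; [split; try lia | by rewrite prednK //; lia | by []].
  by move=> s hs; congr f; lia.
(* Submodularity: the new value does not fall below the left neighbour. *)
have ax : f k.-1 <= f' k by lra.
apply: profile_width_le => t [tm [tp [pl l r]]].
case: (pl) => h1 h2 h3 h4.
have c' : f' k.+1 = f k.+1 by rewrite f'E //; lia.
have a' : f' k.-1 = f k.-1 by rewrite f'E //; lia.
have tk : t <> k.
  move=> e; subst t.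
  have [e|n] := eqVneq tp k.+1; first by move: r; rewrite e /= c' => h; lra.
  by move: xc; rewrite (h4 k.+1) ?c' ?ltxx //; lia.
split; last by rewrite f'E.
have [h|] := boolP ((k < tm)%N || (tp < k)%N).
  exact: maximum_away_from_change pl l r h.
rewrite negb_or -!leqNgt => /andP[tmk ktp].
have [e|ntm] := eqVneq tm k.
  subst tm.
  have ek : f k.+1 = f t.
    rewrite -c' -(f'E tk).
    by have [->//|?] := eqVneq t k.+1; rewrite (h4 k.+1) //; lia.
  have [lt|ge] := ltrP (f k) (f t).
    exists k, tp; split; [split=> // s hs | by rewrite ek |].
      by rewrite -(f'E tk) (h4 s) // f'E //; lia.
    by move: r; rewrite !f'E //; lia.
  exfalso; apply: nmk; exists k.-1, tp.
  have eqb : f k = f t by apply: le_anti; rewrite ge -ek bc.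
  split; [split; first lia; first lia; first lia| |].
  - move=> s hs; have [->//|ns] := eqVneq s k.
    by rewrite eqb -(f'E tk) (h4 s) ?f'E //; [apply/eqP | lia].
  - by rewrite prednK //; lia.
  - by move: r; rewrite !f'E //; lia.
have [e|ntp] := eqVneq tp k.
  by move: r; rewrite e a' => h; lra.
exfalso; have [e|n] := eqVneq tp k.+1.
  by move: r; rewrite e /= c' => h; lra.
by move: xc; rewrite -c' -(h4 k.+1) -?(h4 k) ?ltxx //; lia.
Qed.

End OneValue.
End Lexicographic.

(** * Orderings and their reversal *)

Variant transposition_spec i k : nat -> Prop :=
  | TranspositionFirst of k = i : transposition_spec i k i.+1
  | TranspositionSecond of k = i.+1 : transposition_spec i k i
  | TranspositionOther of k <> i & k <> i.+1 : transposition_spec i k k.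

Lemma transpositionP i k : transposition_spec i k (transposition i k).
Proof.
rewrite /transposition; case: eqP => [|ki]; first exact: TranspositionFirst.
by case: eqP; [exact: TranspositionSecond | exact: TranspositionOther].
Qed.

Lemma transpositionK i : involutive (transposition i).
Proof.
move=> k; case: (transpositionP i k) => [->|->|ki ki1].
- by case: (transpositionP i i.+1) => //; lia.
- by case: (transpositionP i i) => //; lia.
- by case: (transpositionP i k).
Qed.

Lemma transposition_le i k m : k <> i ->
  (transposition i m <= k)%N = (m <= k)%N.
Proof. by move=> ki; case: transpositionP; lia. Qed.

Section Orderings.
Variable T : finType.
Implicit Types (O : T -> nat) (A B : T).

Lemma ordering_range O A : is_ordering O -> (1 <= O A <= #|T|)%N.
Proof. by move=> [h _ _]; exact: h. Qed.

Lemma ordering_inj O A B : is_ordering O -> O A = O B -> A = B.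
Proof. by move=> [_ h _] e; apply: h => //; rewrite inE. Qed.

Lemma ordering_surj O k : is_ordering O -> (1 <= k <= #|T|)%N ->
  exists A, O A = k.
Proof. by move=> [_ _ h] kr; have [A _ <-] := h k kr; exists A. Qed.

Lemma ordering_comp O (f : nat -> nat) : is_ordering O ->
  (forall k, (1 <= k <= #|T|)%N -> (1 <= f k <= #|T|)%N /\ f (f k) = k) ->
  is_ordering (f \o O).
Proof.
move=> hO hf; split=> [A _|A B _ _ /= e|k kr].
- by have [] := hf _ (ordering_range A hO).
- apply: (ordering_inj hO).
  have [_ <-] := hf _ (ordering_range A hO).
  by have [_ <-] := hf _ (ordering_range B hO); rewrite e.
- have [fr fk] := hf k kr; have [A e] := ordering_surj hO fr.
  by exists A; rewrite //= e.
Qed.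

Lemma ordering_transposition O i : is_ordering O -> (1 <= i <= #|T|.-1)%N ->
  is_ordering (transposition i \o O).
Proof.
move=> hO ir; apply: ordering_comp hO _ => k kr.
by rewrite transpositionK; split => //; case: transpositionP; lia.
Qed.

(** Reading an ordering backwards exchanges the two sides of every level set. *)
Definition reversal k : nat := (#|T|.+1 - k)%N.

Lemma ordering_reversal O : is_ordering O -> is_ordering (reversal \o O).
Proof. by move=> hO; apply: ordering_comp hO _ => k kr; rewrite /reversal;
lia. Qed.

Lemma reversalK O : is_ordering O -> reversal \o (reversal \o O) = O.
Proof.
move=> hO; apply/funext => A /=; have := ordering_range A hO.
by rewrite /reversal; lia.
Qed.

Lemma reversal_transposition O i : is_ordering O -> (1 <= i <= #|T|.-1)%N ->
  reversal \o (transposition i \o O) =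
  transposition (#|T| - i) \o (reversal \o O).
Proof.
move=> hO ir; apply/funext => A /=; have := ordering_range A hO.
rewrite /reversal; move: #|T| ir => m ir Ar.
by case: transpositionP; case: transpositionP; lia.
Qed.

End Orderings.

Section ReversedProfiles.
Variables (R : realType) (N : nat) (L L' : nat -> R).
Hypothesis L'E : forall k, (k <= N)%N -> L' k = L (N - k)%N.

Let L'N k : (k <= N)%N -> L' (N - k)%N = L k.
Proof. by move=> kN; rewrite L'E ?subKn // leq_subr. Qed.

Lemma plateau_reversal t tm tp : plateau N L t tm tp ->
  plateau N L' (N - t) (N - tp) (N - tm).
Proof.
move=> [h1 h2 h3 h4]; split; [lia|lia|lia|] => k kr.
rewrite L'N; last lia.
by rewrite L'E; [apply: h4 | ]; lia.
Qed.

Lemma maximum_reversal t : is_maximum N L t -> is_maximum N L' (N - t).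
Proof.
move=> [tm [tp [pl l r]]]; exists (N - tp)%N, (N - tm)%N.
split; first exact: plateau_reversal; case: pl => h1 h2 h3 h4.
  rewrite (_ : (N - tp).+1 = N - tp.-1)%N; last lia.
  by rewrite !L'N //; lia.
rewrite (_ : (N - tm).-1 = N - tm.+1)%N; last lia.
by rewrite !L'N //; lia.
Qed.

Lemma minimum_reversal t : is_minimum N L t -> is_minimum N L' (N - t).
Proof.
move=> [tm [tp [pl l r]]]; exists (N - tp)%N, (N - tm)%N.
split; first exact: plateau_reversal; case: pl => h1 h2 h3 h4.
  rewrite (_ : (N - tp).+1 = N - tp.-1)%N; last lia.
  by rewrite !L'N //; lia.
rewrite (_ : (N - tm).-1 = N - tm.+1)%N; last lia.
by rewrite !L'N //; lia.
Qed.

End ReversedProfiles.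

Lemma profile_width_reversal (R : realType) (N : nat) (L L' : nat -> R) :
  (forall k, (k <= N)%N -> L' k = L (N - k)%N) ->
  profile_width N L' = profile_width N L.
Proof.
move=> L'E.
have LE k : (k <= N)%N -> L k = L' (N - k)%N.
  by move=> kN; rewrite L'E ?leq_subr // subKn.
apply/(perm_sortP (@ge_total _ R) (@ge_trans _ R) (@ge_anti _ R)).
have iotaP k : k \in iota 1 N.-1 = (1 <= k <= N.-1)%N by rewrite mem_iota; lia.
have iota_rev : perm_eq (iota 1 N.-1) [seq (N - k)%N | k <- iota 1 N.-1].
  apply: uniq_perm; rewrite ?iota_uniq //.
    by rewrite map_inj_in_uniq ?iota_uniq // => a b; rewrite !iotaP; lia.
  move=> k; rewrite iotaP; apply/idP/mapP => [kr|[l]].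
    by exists (N - k)%N; rewrite ?iotaP; lia.
  by rewrite iotaP => lr ->; lia.
apply: (@perm_trans _ [seq L' t | t <- [seq (N - k)%N | k <- iota 1 N.-1] &
    `[< is_maximum N L' t >]]).
  by apply: perm_map; apply: perm_filter.
rewrite filter_map -map_comp.
rewrite (@eq_in_filter _ _ (fun t => `[< is_maximum N L t >])); last first.
  move=> k; rewrite iotaP => kr /=; apply: asbool_equiv_eq; split.
    move=> /(maximum_reversal LE); rewrite subKn //; lia.
  exact: maximum_reversal.
rewrite (@eq_in_map _ _ _ L _).1 // => k;
rewrite mem_filter iotaP => /andP[_ kr] /=.
by rewrite LE //; lia.
Qed.

(** * Thinning a locally thin ordering *)

Section Thinning.
Variables (R : realType) (n : nat) (M : topologicalType).
Variables (C : brick_complex R n M) (w : set M -> R).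
Hypothesis hw : weight_system C w.
Implicit Types (A B D : brick C) (O : brick C -> nat).

Local Notation N := #|brick C|.
Local Notation Lam O := (level_weight w O).
Local Notation S O j := (level_set O j).
Local Notation W := (shared_weight w).

Lemma level_set_ext O O' j : (forall A, (O' A <= j)%N = (O A <= j)%N) ->
  S O' j = S O j.
Proof.
move=> e; have lt A : (j < O' A)%N = (j < O A)%N by rewrite !ltnNge e.
by apply/seteqP; split => F [A [B [Aj Bj AF BF]]]; exists A, B;
  rewrite ?e ?lt in Aj Bj *.
Qed.

Lemma level_weight_ext O O' j : (forall A, (O' A <= j)%N = (O A <= j)%N) ->
  Lam O' j = Lam O j.
Proof. by move=> e; rewrite /level_weight (level_set_ext e). Qed.

Lemma level_set_reversal O j : is_ordering O -> (j <= N)%N ->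
  S (@reversal (brick C) \o O) (N - j) = S O j.
Proof.
move=> hO jN.
have e A : ((reversal (brick C) (O A)) <= N - j)%N = (j < O A)%N.
  by have := ordering_range A hO; rewrite /reversal; lia.
apply/seteqP; split => F [A [B [Aj Bj AF BF]]]; exists B, A; split => //.
- by move: Bj; rewrite ltnNge e -leqNgt.
- by move: Aj; rewrite /= e.
- by rewrite /= e.
- by rewrite ltnNge /= e -leqNgt.
Qed.

Lemma level_weight_reversal O k : is_ordering O -> (k <= N)%N ->
  Lam (@reversal (brick C) \o O) k = Lam O (N - k)%N.
Proof.
move=> hO kN; rewrite /level_weight -(level_set_reversal hO (leq_subr k N)).
by rewrite subKn.
Qed.

Lemma width_reversal O : is_ordering O ->
  width w (@reversal (brick C) \o O) = width w O.
Proof.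
move=> hO; apply: profile_width_reversal => k kN; exact: level_weight_reversal.
Qed.

Lemma thins_once_ordering O O' : is_ordering O -> thins_once w O O' ->
  is_ordering O'.
Proof. by move=> hO [i [ir -> _]]; exact: ordering_transposition. Qed.

Lemma thins_to_reversal O O' : thins_to w O O' -> is_ordering O ->
  is_ordering O' /\
  thins_to w (@reversal (brick C) \o O) (@reversal (brick C) \o O').
Proof.
elim=> {O O'} [ O O' t hO | O hO | O1 O2 O3 _ h1 _ h2 hO].
- have hO' := thins_once_ordering hO t; split => //; apply: rt_step.
  case: t => i [ir e le]; exists (N - i)%N; split; first lia.
    by rewrite e reversal_transposition.
  by rewrite !width_reversal.
- by split => //; exact: rt_refl.
- have [hO2 t1] := h1 hO; have [hO3 t2] := h2 hO2.
  by split => //; exact: rt_trans t1 t2.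
Qed.

Lemma locally_thin_reversal O : is_ordering O -> locally_thin w O ->
  locally_thin w (@reversal (brick C) \o O).
Proof.
move=> hO hthin [ O' t lt]; apply: hthin.
have [hO' t'] := thins_to_reversal t (ordering_reversal hO).
exists (@reversal (brick C) \o O'); first by rewrite -{1}(reversalK hO).
by rewrite width_reversal // -(width_reversal hO).
Qed.

(** A thinning of a locally thin ordering keeps its width. *)
Lemma locally_thin_step O O' : locally_thin w O -> thins_once w O O' ->
  locally_thin w O'.
Proof.
move=> hthin t [ O'' t' lt]; apply: hthin; exists O''.
  by apply: rt_trans t'; exact: rt_step.
by case: t => i [_ _ le]; exact: lt_le_trans lt le.
Qed.

Lemma swap_not_lt O i : locally_thin w O -> (1 <= i <= N.-1)%N ->
  ~ (width w (transposition i \o O) < width w O)%O.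
Proof.
move=> hthin ir lt; apply: hthin; exists (transposition i \o O) => //.
by apply: rt_step; exists i; split => //; exact: ltW.
Qed.

Lemma level_weight_swap O i k : k <> i ->
  Lam (transposition i \o O) k = Lam O k.
Proof. by move=> ki; apply: level_weight_ext => A; exact: transposition_le. Qed.

Lemma level_weight_pred O A : is_ordering O ->
  Lam O (O A).-1 = Lam O (O A) + strength w (S O (O A)) A.
Proof.
move=> hO; rewrite !level_weight_cut strength_flow.
apply: cut_remove => // [|B]; first exact: shared_weight_sym.
have := ordering_range A hO; have := ordering_range B hO.
by case: eqVneq => [->|/eqP BA]; [|have := BA \o @ordering_inj _ _ _ _ hO]; lia.
Qed.

(** The brick [A] enters at level [j.+1] by crossing the level set at [j]. *)
Lemma level_weight_succ O A j : is_ordering O -> O A = j.+1 ->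
  Lam O j.+1 = Lam O j + strength w (S O j) A.
Proof.
move=> hO e; have := level_weight_pred A hO; rewrite e /= => ->.
rewrite !strength_flow (@flow_flip _ _ _ (fun B => O B <= j.+1)%N (fun B => O B <= j)%N).
  lra.
move=> D; case: eqVneq => [->|/eqP DA]; first by rewrite e leqnn ltnn.
by have := DA \o @ordering_inj _ _ _ _ hO; rewrite e addbF => h; lia.
Qed.

(** After the exchange, the first [i] bricks are the first [i.+1] bricks without
    [A]. *)
Lemma swapped_level_weight O A i : is_ordering O -> (1 <= i <= N.-1)%N ->
  O A = i ->
  Lam (transposition i \o O) i = Lam O i.+1 + strength w (S O i.+1) A.
Proof.
move=> hO ir e; rewrite !level_weight_cut strength_flow.
apply: cut_remove => [ | |B]; [exact: shared_weight_sym | by rewrite e|].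
rewrite /=; case: (eqVneq B A) => [->|/eqP BA].
  by rewrite e; case: transpositionP; lia.
have := BA \o @ordering_inj _ _ _ _ hO; rewrite e => h.
by case: transpositionP; lia.
Qed.

Lemma strength_mono O A i j : (O A <= i)%N -> (i <= j)%N ->
  strength w (S O i) A <= strength w (S O j) A.
Proof.
move=> Ai ij; rewrite !strength_flow; apply: flow_mono => // [B D|B Bi].
  exact: shared_weight_ge0.
exact: leq_trans ij.
Qed.

Lemma strength_add O A B i : is_ordering O -> (O A <= i)%N -> O B = i.+1 ->
  strength w (S O i.+1) A = strength w (S O i) A + 2 * W A B.
Proof.
move=> hO Ai e; rewrite !strength_flow; apply: flow_add => //.
  by rewrite e ltnn.
move=> D; case: eqVneq => [->|/eqP DB]; first by rewrite e leqnn orbT.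
by have := DB \o @ordering_inj _ _ _ _ hO; rewrite e orbF => h; lia.
Qed.

(** Moving [A] up one place replaces [Lambda] at its position by a value smaller
    than the next one, which cannot increase the width. If [Lambda] decreased
    there, the position would be a strict maximum and the move would reduce the
    width. *)
Lemma move_up O A j : is_ordering O -> locally_thin w O ->
  (O A <= j <= N)%N -> strength w (S O j) A < 0 ->
  [/\ Lam O (O A).-1 < Lam O (O A),
      forall k, (O A <= k < j)%N -> Lam O k <= Lam O k.+1 &
      exists O', [/\ is_ordering O', locally_thin w O', O' A = j &
        forall k, (j <= k)%N -> forall D, (O' D <= k)%N = (O D <= k)%N]].
Proof.
(* Induction on the number of places that A has to move. *)
move=> + + /andP[Aj jN]; move/subnKC: (Aj); move: (j - O A)%N => d.
elim: d O {Aj} => [|d IH] O dE hO hthin neg.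
  have e : O A = j by lia.
  split=> [|k|]; [|lia|by exists O].
  by have := level_weight_pred A hO; rewrite e; lra.
have Ar := ordering_range A hO.
have ir : (1 <= O A <= N.-1)%N by lia.
have le_neg k : (O A <= k <= j)%N -> strength w (S O k) A < 0.
  by move=> kr; apply: le_lt_trans neg; apply: strength_mono; lia.
pose O' := transposition (O A) \o O.
have neg0 : strength w (S O (O A)) A < 0 by apply: le_neg; lia.
have neg1 : strength w (S O (O A).+1) A < 0 by apply: le_neg; lia.
have mono : strength w (S O (O A)) A <= strength w (S O (O A).+1) A.
  exact: strength_mono.
have predE := level_weight_pred A hO.
have swapE : Lam O' (O A) = Lam O (O A).+1 + strength w (S O (O A).+1) A.
  exact: swapped_level_weight.
have same k : k <> O A -> Lam O' k = Lam O k by exact: level_weight_swap.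
have bc : Lam O (O A) <= Lam O (O A).+1.
  rewrite leNgt; apply/negP => cb; apply: (swap_not_lt hthin ir).
  apply: (width_lt_of_lowered_maximum ir same); [|lra|lra].
  exists (O A).-1, (O A).+1.
  rewrite prednK; last lia; split; [split; try lia | lra | by []].
  by move=> k kr; congr level_weight; lia.
have step : thins_once w O O'.
  exists (O A); split => //; apply: (width_le_of_ascent ir same); lra.
have hO' : is_ordering O' := thins_once_ordering hO step.
have hthin' := locally_thin_step hthin step.
have O'A : O' A = (O A).+1.
  by rewrite /O' /=; case: transpositionP.
have below k : (j <= k)%N -> forall D, (O' D <= k)%N = (O D <= k)%N.
  by move=> jk D; apply: transposition_le; lia.
have [ | | _ asc [ O1 [hO1 hthin1 O1A O1E]]] := IH O' _ hO' hthin'.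
- by rewrite O'A; lia.
- by rewrite (level_set_ext (below j (leqnn j))).
split; first lra.
- move=> k kr; have [->//|/eqP kA] := eqVneq k (O A).
  by rewrite -!same; [apply: asc; rewrite O'A|..]; lia.
- by exists O1; split => // k jk D; rewrite O1E // below.
Qed.

Lemma move_down O A j : is_ordering O -> locally_thin w O ->
  (j < O A)%N -> strength w (S O j) A < 0 ->
  exists O', [/\ is_ordering O', locally_thin w O', O' A = j.+1 &
    forall k, (k <= j)%N -> forall D, (O' D <= k)%N = (O D <= k)%N].
Proof.
move=> hO hthin jA neg; have Ar := ordering_range A hO.
have jN : (j <= N)%N by lia.
have [ | | _ _ [ O1 [hO1 hthin1 O1A O1E]]] := @move_up _ A (N - j)%N
    (ordering_reversal hO) (locally_thin_reversal hO hthin).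
- by rewrite /comp /reversal; lia.
- by rewrite level_set_reversal.
exists (@reversal (brick C) \o O1); split.
- exact: ordering_reversal.
- exact: locally_thin_reversal.
- by rewrite /= O1A /reversal; lia.
- move=> k kj D; have := O1E (N - k)%N (leq_sub2l _ kj) D.
  have := ordering_range D hO; have := ordering_range D hO1.
  by rewrite /comp /reversal; lia.
Qed.

(** Otherwise the exchange of [A] and [B] lowers [Lambda] at the maximum [j]. *)
Lemma interfere_at_maximum O A B j : is_ordering O -> locally_thin w O ->
  O A = j -> O B = j.+1 -> is_maximum N (Lam O) j -> Lam O j.-1 < Lam O j ->
  strength w (S O j) A <= 0 -> strength w (S O j) B <= 0 ->
  interfere w (S O j) A B.
Proof.
move=> hO hthin Aj Bj mj ab Aneg Bneg; have Br := ordering_range B hO.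
have Ar := ordering_range A hO.
have jr : (1 <= j <= N.-1)%N by lia.
have swapE := swapped_level_weight hO jr Aj.
have succE := level_weight_succ hO Bj.
have addE := strength_add hO (_ : O A <= j)%N Bj.
rewrite /interfere -/(shared_weight w A B) !ler0_norm //.
rewrite leNgt; apply/negP => lt; apply: (swap_not_lt hthin jr).
apply: (width_lt_of_lowered_maximum jr _ mj ab).
  by move=> k; exact: level_weight_swap.
by rewrite swapE succE addE ?Aj //; lra.
Qed.

Lemma maximum_neighbours L j : is_maximum N L j ->
  L j.-1 <= L j /\ L j.+1 <= (L j : R).
Proof.
move=> [tm [tp [[h1 h2 h3 h4] l r]]]; split.
  have [e|ne] := eqVneq tm j.-1.
    by move: l; rewrite e prednK; [exact: ltW | lia].
  by rewrite (h4 j.-1) //; lia.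
have [e|ne] := eqVneq tp j.+1; first by move: r; rewrite e /=; exact: ltW.
by rewrite (h4 j.+1) //; lia.
Qed.

Lemma interfere_shared O A B j : (O A <= j < O B)%N -> strength w (S O j) A < 0 ->
  interfere w (S O j) A B -> brick_facets B `&` S O j !=set0.
Proof.
move=> /andP[Aj Bj] neg; rewrite /interfere => h.
have [F [AF BF]] : brick_facets A `&` brick_facets B !=set0.
  apply/set0P/negP => /eqP e; move: h; rewrite e /weight fsbig_set0 mulr0.
  by rewrite ltr0_norm //; have := normr_ge0 (strength w (S O j) B); lra.
by exists F; split => //; exists A, B.
Qed.

(** Once [A] has been moved to position [j], the level [j] is still a maximum,
    and the partner is the brick at position [j.+1]. *)
Lemma shortening_partner O A j : is_ordering O -> locally_thin w O ->
  is_maximum N (Lam O) j -> (O A <= j)%N -> strength w (S O j) A < 0 ->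
  exists B, [/\ (j < O B)%N, shortening w (S O j) B & interfere w (S O j) A B].
Proof.
move=> hO hthin mj Aj neg.
have jr : (1 <= j <= N.-1)%N by case: mj => tm [tp [[]]].
have [ | _ _ [ O1 [hO1 hthin1 O1A O1E]]] := move_up hO hthin _ neg; first lia.
have setE : S O1 j = S O j := level_set_ext (O1E j (leqnn j)).
have LE k : (j <= k)%N -> Lam O1 k = Lam O k by move=> /O1E /level_weight_ext.
have [B O1B] : exists B, O1 B = j.+1 by apply: ordering_surj hO1 _; lia.
have ab : Lam O1 j.-1 < Lam O1 j.
  by have := level_weight_pred A hO1; rewrite O1A setE => ->; lra.
have m1 : is_maximum N (Lam O1) j.
  case: mj => tm [tp [[h1 h2 h3 h4] l r]]; exists j.-1, tp.
  rewrite prednK; last lia; split => //; last by rewrite !LE //; lia.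
  split; try lia; move=> k kr; rewrite !LE; try lia.
  by apply: h4; lia.
have [_ cb] := maximum_neighbours m1.
have Bneg : strength w (S O1 j) B <= 0.
  by have := level_weight_succ hO1 O1B; lra.
have jB : (j < O B)%N by rewrite ltnNge -(O1E j) // O1B ltnn.
have AB : interfere w (S O j) A B.
  by rewrite -setE; apply: interfere_at_maximum => //; rewrite setE; lra.
exists B; split => //; split; last by rewrite -setE.
by apply: interfere_shared neg AB; rewrite Aj.
Qed.

(** With [A] moved up to position [j] and [B] moved down to [j.+1], the level
    [j] is a strict maximum. *)
Lemma strict_shortenings_interfere O A B j : is_ordering O ->
  locally_thin w O -> (O A <= j < O B)%N ->
  strength w (S O j) A < 0 -> strength w (S O j) B < 0 ->
  interfere w (S O j) A B.
Proof.
move=> hO hthin /andP[Aj jB] Aneg Bneg.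
have Br := ordering_range B hO; have Ar := ordering_range A hO.
have [ | _ _ [ O1 [hO1 hthin1 O1A O1E]]] := move_up hO hthin _ Aneg; first lia.
have setE : S O1 j = S O j := level_set_ext (O1E j (leqnn j)).
have jB1 : (j < O1 B)%N by rewrite ltnNge O1E // -ltnNge.
have [|O2 [hO2 hthin2 O2B O2E]] := move_down hO1 hthin1 jB1;
first by rewrite setE.
have setE2 : S O2 j = S O j by rewrite (level_set_ext (O2E j (leqnn j))).
have O2A : O2 A = j.
  apply/eqP; rewrite eqn_leq O2E // O1A leqnn /= leqNgt.
  apply/negP => lt; have : (O2 A <= j.-1)%N by lia.
  by rewrite O2E ?O1A; lia.
have predE := level_weight_pred A hO2; rewrite O2A setE2 in predE.
have succE := level_weight_succ hO2 O2B; rewrite setE2 in succE.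
rewrite -setE2; apply: interfere_at_maximum => //; rewrite ?setE2; try lra.
exists j.-1, j.+1; rewrite prednK; last lia.
split; [split; try lia | lra | rewrite /=; lra].
by move=> k kr; congr level_weight; lia.
Qed.

Lemma interfereC (X : set (set M)) A B : interfere w X A B -> interfere w X B A.
Proof. by rewrite /interfere addrC setIC. Qed.

Lemma strict_shorteningP O j A : strength w (S O j) A < 0 ->
  strict_shortening w (S O j) A.
Proof.
move=> neg; split => //; split; last exact: ltW.
apply/set0P/negP => /eqP e; move: neg; rewrite /strength.
have -> : interior_facets A `&` S O j = set0.
  by apply/seteqP; split => // F [[AF _] SF]; rewrite -e.
rewrite {2}/weight fsbig_set0 subr0 ltNge => /negP; apply.
by apply: (weight_ge0 hw) => F [[AF _] _]; exists A.
Qed.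

(** The two sides of the level set form the required partition. The shortening
    move on the side without a strict one is the partner of a strict one. *)
Lemma maximum_unstable O j : is_ordering O -> locally_thin w O ->
  is_maximum N (Lam O) j -> (exists A, strength w (S O j) A < 0) ->
  unstable_minimal C w (S O j).
Proof.
move=> hO hthin mj strict; split; first exact: level_set_proper.
have jr : (1 <= j <= N.-1)%N by case: mj => tm [tp [[]]].
have partnerA A : (O A <= j)%N -> strength w (S O j) A < 0 -> exists B,
    [/\ (j < O B)%N, shortening w (S O j) B & interfere w (S O j) A B].
  exact: shortening_partner.
have partnerB B : (j < O B)%N -> strength w (S O j) B < 0 -> exists A,
    [/\ (O A <= j)%N, shortening w (S O j) A & interfere w (S O j) A B].
  move=> jB Bneg.
  have setE : S (@reversal (brick C) \o O) (N - j) = S O j.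
    by apply: level_set_reversal => //; lia.
  have Br := ordering_range B hO.
  have [ | | | A [Aj Ash AB]] := @shortening_partner _ B (N - j)%N
      (ordering_reversal hO) (locally_thin_reversal hO hthin).
  - by apply: maximum_reversal mj => k kN; exact: level_weight_reversal.
  - by rewrite /comp /reversal; lia.
  - by rewrite setE.
  exists A; rewrite setE in Ash AB; split => //; last exact: interfereC.
  by have := ordering_range A hO; move: Aj; rewrite /comp /reversal; lia.
exists [set A | (O A <= j)%N], [set B | (j < O B)%N]; split.
  split.
  - have [ | A e] := ordering_surj (k := 1) hO; first lia.
    by exists A; rewrite /mkset e; lia.
  - have [ | A e] := ordering_surj (k := N) hO; first lia.
    by exists A; rewrite /mkset e; lia.
  - by apply/seteqP; split => // A _ /=; case: (leqP (O A) j); [left|right].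
  - by apply/seteqP; split => // A /= [Aj]; rewrite ltnNge Aj.
split.
- by move=> A B /= Aj jB F [AF BF]; exists A, B.
- have [A neg] := strict; have sA := strict_shorteningP neg.
  case: (leqP (O A) j) => Aj.
    have [B [jB sB _]] := partnerA A Aj neg.
    by split; [exists A => //; case: sA | exists B | left; exists A].
  have [B [jB sB _]] := partnerB A Aj neg.
  by split; [exists B | exists A => //; case: sA | right; exists A].
- by split=> [A Aj [_ neg]|B jB [_ neg]]; [exact: partnerA | exact: partnerB].
- move=> A B /= Aj jB [_ Aneg] [_ Bneg].
  by apply: strict_shortenings_interfere => //; rewrite Aj.
Qed.

(** The strict rise or fall next to the level is the strength of the brick that
    crosses it. *)
Lemma extremal_maximum_strict O j : is_ordering O ->
  is_extremal_maximum N (Lam O) j -> exists A, strength w (S O j) A < 0.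
Proof.
move=> hO [tm [tp [[h1 h2 h3 h4] l r [e|e]]]].
  have [|A Aj] := ordering_surj (k := j) hO; first lia.
  exists A; have := level_weight_pred A hO.
  by move: l; rewrite Aj e /=; lra.
have [|B Bj] := ordering_surj (k := j.+1) hO; first lia.
exists B; have := level_weight_succ hO Bj.
have <- : tp = j.+1 by lia.
by move: r; rewrite -e; lra.
Qed.

(** By [move_up] the profile rises at [A] and then does not fall up to level
    [j], whereas it falls somewhere before [j], after which it is constant. *)
Lemma minimum_no_strict_below O A j : is_ordering O -> locally_thin w O ->
  is_minimum N (Lam O) j -> (O A <= j)%N -> 0 <= strength w (S O j) A.
Proof.
move=> hO hthin [tm [tp [[h1 h2 h3 h4] l _]]] Aj; rewrite leNgt;
apply/negP => neg.
have [|up asc _] := move_up hO hthin _ neg; first lia.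
have Ar := ordering_range A hO.
have [lt|le] := ltnP tm (O A).
  have [e|ne] := eqVneq (O A).-1 tm.
    by move: up l; rewrite -e prednK; [lra | lia].
  by move: up; rewrite -(h4 (O A).-1) -?(h4 (O A)) ?ltxx //; lia.
have : Lam O tm <= Lam O tm.+1 by apply: asc; lia.
by move: l; lra.
Qed.

Lemma minimum_stable O j : is_ordering O -> locally_thin w O ->
  is_minimum N (Lam O) j -> stable_minimal C w (S O j).
Proof.
move=> hO hthin mj; split; first exact: level_set_proper.
have jr : (1 <= j <= N.-1)%N by case: mj => tm [tp [[]]].
move=> [A [_]]; apply/negP; rewrite -leNgt.
have [Aj|jA] := leqP (O A) j; first exact: minimum_no_strict_below.
have Ar := ordering_range A hO.
rewrite -(@level_set_reversal O j) //; last lia.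
apply: minimum_no_strict_below.
- exact: ordering_reversal.
- exact: locally_thin_reversal.
- by apply: minimum_reversal mj => k kN; exact: level_weight_reversal.
- by rewrite /comp /reversal; lia.
Qed.

End Thinning.

Theorem theorem4p1 (R : realType) (n : nat) (M : topologicalType)
    (C : brick_complex R n M) (w : set M -> R) (O : brick C -> nat)
    (hw : weight_system C w) (hO : is_ordering O)
    (hthin : locally_thin w O) :
  (forall j : nat, is_maximum #|brick C| (level_weight w O) j ->
     stable_minimal C w (level_set O j) \/
     unstable_minimal C w (level_set O j)) /\
  (forall j : nat, is_extremal_maximum #|brick C| (level_weight w O) j ->
     unstable_minimal C w (level_set O j)) /\
  (forall j : nat, is_minimum #|brick C| (level_weight w O) j ->
     stable_minimal C w (level_set O j)).
Proof.
split=> [j mj|].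
  have [neg|none] := pselect (exists A : brick C, strength w (level_set O j) A < 0).
    by right; exact: (maximum_unstable hw).
  left; split; first exact: level_set_proper.
  by move=> [A [_ neg]]; apply: none; exists A.
split=> j mj; last exact: (minimum_stable hw).
apply: maximum_unstable => //; last exact: extremal_maximum_strict mj.
by case: mj => tm [tp [pl l r _]]; exists tm, tp.
Qed.
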